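(* Let $M$ be a smooth manifold and suppose that $F$ is a complete Finsler structure on $M$. Then for any $x,y\in M$, there is a geodesic with respect to $F$ connecting $x$ to $y$.
   Context: A Finsler structure on a smooth manifold $M$ is a continuous function $F\colon TM\to[0,\infty)$ such that for every $x\in M$ the restriction $F(x,\cdot)$ to $T_xM$ is a weak norm, i.e. $F(x,v_1+v_2)\le F(x,v_1)+F(x,v_2)$ for all $v_1,v_2\in T_xM$; $F(x,\lambda v)=\lambda F(x,v)$ for all $\lambda\ge 0$ and $v\in T_xM$; and $F(x,v)=0$ if and only if $v=0$. (No symmetry and no further regularity is assumed.) The length of a piecewise $C^1$-path $\beta\colon[a,b]\to M$ is $l_F(\beta)=\int_a^bF(\beta(s),\dot\beta(s))\,ds$. The induced (possibly non-symmetric) metric $d(F)(x,y)$ is the infimum of $l_F(\beta)$ over all piecewise $C^1$-paths $\beta$ from $x$ to $y$, and is defined to be $\infty$ if there is no such path. For a continuous path $\gamma\colon[a,b]\to M$, $l(d(F))(\gamma)$ is the supremum of $\sum_{i=0}^n d(F)(\gamma(t_i),\gamma(t_{i+1}))$ over all finite partitions $a=t_0\le t_1\le\dots\le t_{n+1}=b$. The path is rectifiable if $l(d(F))(\gamma)<\infty$. A path $\gamma\colon[a,b]\to M$ is a geodesic with respect to $F$ if it is continuous, rectifiable and $l(d(F))(\gamma)=d(F)(\gamma(a),\gamma(b))$. A sequence $(x_i)$ in $M$ is Cauchy for $d(F)$ if for every $\epsilon>0$ there is $N$ such that $d(F)(x_m,x_n)<\epsilon$ for all $n\ge m\ge N$.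 $F$ is complete if for every such Cauchy sequence there is $x\in M$ with $d(F)(x_i,x)\to0$.
   Formalization: The formal theorem assumes that x and y lie in the same connected component of M; for points in different components no continuous path joins them, so the claim as stated fails when M is not connected. *)

(* Defs.v *)
From HB Require Import structures.
From mathcomp Require Import all_boot all_order all_algebra.
From mathcomp Require Import all_classical all_reals all_analysis.

Set Implicit Arguments.
Unset Strict Implicit.
Unset Printing Implicit Defensive.

Import Order.TTheory GRing.Theory Num.Theory.
Import numFieldNormedType.Exports.

Local Open Scope classical_set_scope.
Local Open Scope ring_scope.

(* [f] is C^k on the open set [U]. *)
Fixpoint Ck {R : realType} {V W : normedModType R} (k : nat) (U : set V)
    (f : V -> W) : Prop :=
  match k with
  | 0%N => forall p, U p -> {for p, continuous f}
  | k'.+1 => (forall p, U p -> differentiable f p) /\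
             forall v : V, Ck k' U ('D_v f)
  end.

Definition smooth {R : realType} {V W : normedModType R} (U : set V)
  (f : V -> W) : Prop := forall k, Ck k U f.

(* The maps [chart i] and [chart_inv i] are total functions; only their values
   on [chart_dom i] and on its image are meaningful. *)
Record smooth_manifold (R : realType) (n : nat) := SmoothManifold {
  mfd_space :> topologicalType ;
  mfd_hausdorff : hausdorff_space mfd_space ;
  mfd_second_countable : @second_countable mfd_space ;
  chart_index : Type ;
  chart_dom : chart_index -> set mfd_space ;
  chart : chart_index -> mfd_space -> 'rV[R]_n ;
  chart_inv : chart_index -> 'rV[R]_n -> mfd_space ;
  chart_cover : forall x, exists i, chart_dom i x ;
  chart_dom_open : forall i, open (chart_dom i) ;
  chart_image_open : forall i, open (chart i @` chart_dom i) ;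
  chartK : forall i x, chart_dom i x -> chart_inv i (chart i x) = x ;
  chart_continuous : forall i x, chart_dom i x ->
    {for x, continuous (chart i)} ;
  chart_inv_continuous : forall i p, (chart i @` chart_dom i) p ->
    {for p, continuous (chart_inv i)} ;
  transition_smooth : forall i j,
    smooth (chart i @` (chart_dom i `&` chart_dom j))
      (chart j \o chart_inv i)
}.

Section TangentBundle.
Context {R : realType} {n : nat} (M : smooth_manifold R n).

(* A tangent vector at [x] is the family of its components in all the charts
   around [x], related by the differentials of the transition maps; the
   component is set to 0 in the charts whose domain does not contain [x]. *)
Definition is_tangent (x : M) : {pred (chart_index M -> 'rV[R]_n)} :=
  fun v => `[<
    (forall i, ~ chart_dom i x -> v i = 0) /\
    (forall i j, chart_dom i x -> chart_dom j x ->
      v j = 'd (chart j \o chart_inv i) (chart i x) (v i)) >].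

Record tangent (x : M) := Tangent {
  tangent_val : chart_index M -> 'rV[R]_n ;
  _ : tangent_val \in is_tangent x
}.

HB.instance Definition _ x := [isSub for @tangent_val x].
HB.instance Definition _ x := [Choice of tangent x by <:].

Fact is_tangent_submod x : submod_closed (is_tangent x).
Proof.
split; first by apply/asboolP; split=> // i j _ _; rewrite /= linear0.
move=> a u v /asboolP[u0 uE] /asboolP[v0 vE]; apply/asboolP; split=> [i xi|].
  by change (a *: u i + v i = 0); rewrite u0// v0// scaler0 addr0.
move=> i j xi xj.
change (a *: u j + v j =
  'd (chart j \o chart_inv i) (chart i x) (a *: u i + v i)).
by rewrite linearP -uE// -vE.
Qed.

HB.instance Definition _ x := GRing.isSubmodClosed.Build R
  (chart_index M -> 'rV[R]_n) (is_tangent x)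
  (GRing.submod_closed_semi (is_tangent_submod x)).
HB.instance Definition _ x := [SubChoice_isSubLmodule of tangent x by <:].

Definition tangent_bundle := {x : M & tangent x}.

HB.instance Definition _ := Choice.on tangent_bundle.

Definition tvec (x : M) (v : tangent x) : tangent_bundle := existT _ x v.

(* The chart of the tangent bundle induced by the chart [i] of the base; it is
   meaningful over [chart_dom i]. *)
Definition tchart (i : chart_index M) (u : tangent_bundle) :
    'rV[R]_n * 'rV[R]_n :=
  (chart i (projT1 u), tangent_val (projT2 u) i).

(* The topology that makes every [tchart i] a homeomorphism from the open set
   of vectors based in [chart_dom i] onto its (open) image. *)
Definition tangent_open : set (set tangent_bundle) :=
  [set A | forall i, exists2 W : set ('rV[R]_n * 'rV[R]_n), open W &
    forall u, chart_dom i (projT1 u) -> (A u <-> W (tchart i u))].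

Fact tangent_openT : tangent_open setT.
Proof. by move=> i; exists setT => //; exact: openT. Qed.

Fact tangent_openI : setI_closed tangent_open.
Proof.
move=> A B Ao Bo i; have [W Wo WE] := Ao i; have [P Po PE] := Bo i.
exists (W `&` P); first exact: openI.
by move=> u ui; split=> [[/(WE _ ui) ? /(PE _ ui)]//|[/(WE _ ui) ? /(PE _ ui)]].
Qed.

Fact tangent_open_bigU (I : Type) (f : I -> set tangent_bundle) :
  (forall k, tangent_open (f k)) -> tangent_open (\bigcup_k f k).
Proof.
move=> fo i.
have WP k : exists W : set ('rV[R]_n * 'rV[R]_n),
    open W /\ forall u, chart_dom i (projT1 u) -> (f k u <-> W (tchart i u)).
  by have [W Wo WE] := fo k i; exists W.
have [W WE] := choice WP.
exists (\bigcup_k W k); first by apply: bigcup_open => k _; have [] := WE k.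
by move=> u ui; split=> -[k _ fk]; exists k => //; apply/(proj2 (WE k) _ ui).
Qed.

HB.instance Definition _ := isOpenTopological.Build tangent_bundle
  tangent_openT tangent_openI tangent_open_bigU.

End TangentBundle.

Section Paths.
Context {R : realType} {n : nat} {M : smooth_manifold R n}.

(* [v] is the velocity of [beta] at [t], with time restricted to [A]: one-sided
   if [t] is an endpoint of the interval [A]. *)
Definition has_velocity (A : set R) (beta : R -> M) (t : R)
    (v : tangent (beta t)) : Prop :=
  forall i, chart_dom i (beta t) ->
    (s - t)^-1 *: (chart i (beta s) - chart i (beta t))
      @[s --> within A t^'] --> tangent_val v i.

Definition C1_path (c d : R) (beta : R -> M) : Prop :=
  exists V : forall t, tangent (beta t),
    (forall t, c <= t <= d -> has_velocity `[c, d] (V t)) /\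
    {within `[c, d], continuous (fun t => tvec (V t))}.

Definition piecewise_C1_path (a b : R) (beta : R -> M) : Prop :=
  exists2 s, itv_partition a b s &
    forall k, (k < size s)%N -> C1_path (nth b (a :: s) k) (nth b s k) beta.

(* Takes the value 0 where there is no velocity, that is, for a piecewise C^1
   path, at finitely many times. *)
Definition velocity (A : set R) (beta : R -> M) (t : R) : tangent (beta t) :=
  xget 0 [set v | has_velocity A v].

End Paths.

Record finsler {R : realType} {n : nat} (M : smooth_manifold R n) := Finsler {
  finsler_fun :> tangent_bundle M -> R ;
  finsler_continuous : continuous finsler_fun ;
  finsler_ge0 : forall u, 0 <= finsler_fun u ;
  finsler_subadd : forall (x : M) (v1 v2 : tangent x),
    finsler_fun (tvec (v1 + v2)) <=
      finsler_fun (tvec v1) + finsler_fun (tvec v2) ;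
  finsler_homog : forall (x : M) (l : R) (v : tangent x), 0 <= l ->
    finsler_fun (tvec (l *: v)) = l * finsler_fun (tvec v) ;
  finsler_eq0 : forall (x : M) (v : tangent x),
    finsler_fun (tvec v) = 0 <-> v = 0
}.

Section FinslerMetric.
Context {R : realType} {n : nat} {M : smooth_manifold R n} (F : finsler M).
Local Open Scope ereal_scope.

Definition finsler_length (a b : R) (beta : R -> M) : \bar R :=
  \int[lebesgue_measure]_(s in `[a, b])
    (F (tvec (velocity `[a, b] beta s)))%:E.

Definition finsler_dist (x y : M) : \bar R :=
  ereal_inf [set l | exists a b beta,
    [/\ piecewise_C1_path a b beta, beta a = x, beta b = y &
        l = finsler_length a b beta]].

Definition metric_length (a b : R) (gamma : R -> M) : \bar R :=
  ereal_sup [set l | exists (m : nat) (t : nat -> R),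
    [/\ t 0%N = a, t m.+1 = b,
        (forall i, (i <= m)%N -> (t i <= t i.+1)%R) &
        l = \sum_(0 <= i < m.+1) finsler_dist (gamma (t i)) (gamma (t i.+1))]].

Definition rectifiable (a b : R) (gamma : R -> M) : Prop :=
  metric_length a b gamma < +oo.

Definition geodesic (a b : R) (gamma : R -> M) : Prop :=
  [/\ {within `[a, b], continuous gamma}, rectifiable a b gamma &
      metric_length a b gamma = finsler_dist (gamma a) (gamma b)].

(* The metric need not be symmetric: the order of the arguments matters. *)
Definition finsler_cauchy (u : nat -> M) : Prop :=
  forall eps : R, (0 < eps)%R -> exists N : nat,
    forall m k : nat, (N <= m)%N -> (m <= k)%N ->
      finsler_dist (u m) (u k) < eps%:E.

Definition finsler_complete : Prop :=
  forall u : nat -> M, finsler_cauchy u ->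
    exists x : M, finsler_dist (u i) x @[i --> \oo] --> 0.

End FinslerMetric.

(* Main.v *)
Require Import Defs.
From mathcomp Require Import all_boot all_order all_algebra.
From mathcomp Require Import all_classical all_reals all_analysis.
From mathcomp Require Import measurable_realfun.
From mathcomp Require Import ring lra.

(** This is the Hopf-Rinow theorem for a metric that need not be symmetric.

   The Finsler distance is first described as a purely metric object
   ([finsler_length_space]). It is the infimum of the lengths of chains of C^1
   paths ([finsler_dist_le_chain], [finsler_dist_lt_chain]), whence the
   triangle inequality and, by the intermediate value theorem applied to the
   length of an initial part of a chain, the possibility of splitting any
   upper bound of a distance by an intermediate point. Since [F] is continuous
   and homogeneous, it is comparable with the norm of a chart near any point
   ([finsler_chart_bounds]); straight segments then bound distances from
   above, and a path joining, in either direction, a point to the outside of a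
   small chart ball around it has a length bounded from below
   ([lift_gap_speed]), so that forward balls as well as backward balls
   generate the topology of the manifold.

   The rest of the argument only uses these properties, local compactness and
   forward completeness ([exists_minimizer]). Let [D] be the distance from [x]
   to [y], finite since [x] and [y] are in the same component. By Zorn's lemma
   there is a maximal set [C] of pairs [(s, p)] with [0 <= s <= D] that could
   be part of the graph of a unit speed minimizer from [x] to [y]. A time [s]
   without a point would leave a gap in [C]. The supremum of the times below
   the gap is attained at a point [w] by forward completeness, and compactness
   of a small neighbourhood of [w] gives a point slightly after [w] that is on
   the way to all later points of [C]; adding it contradicts maximality. Hence
   [C] is the graph of a path defined on [[0, D]], along which distances are
   differences of times, and such a path is a geodesic. In comparison with the
   usual proof, neither the compactness of closed balls nor a compactness
   theorem for paths is needed, and only forward Cauchy sequences occur. *)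

Set Implicit Arguments.
Unset Strict Implicit.
Unset Printing Implicit Defensive.

Import Order.TTheory GRing.Theory Num.Theory.
Import numFieldNormedType.Exports.

Local Open Scope classical_set_scope.
Local Open Scope ring_scope.

(** * Minimizers in locally compact asymmetric length spaces *)

Section AsymmetricLengthSpace.
Context {R : realType} {T : topologicalType}.

(** A distance, not assumed symmetric and possibly infinite, that induces the
   topology of [T] through both its forward and its backward balls
   ([als_near], [als_sep]), and for which any bound [s] on [d p q] can be split
   at any [r] by an intermediate point ([als_split]): this last property is what
   remains of being an infimum of lengths of paths. *)
Record asymmetric_length_space (d : T -> T -> \bar R) : Prop := {
  als_ge0 : forall p q, (0 <= d p q)%E ;
  als_refl : forall p, d p p = 0%E ;
  als_triangle : forall p q r, (d p r <= d p q + d q r)%E ;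
  als_near : forall p (e : R), 0 < e ->
    \forall q \near p, (d p q < e%:E)%E /\ (d q p < e%:E)%E ;
  als_sep : forall p U, nbhs p U -> exists2 e : R, 0 < e &
    forall q, (d p q < e%:E)%E \/ (d q p < e%:E)%E -> U q ;
  als_split : forall p q (r s : R), (d p q < s%:E)%E -> 0 <= r <= s ->
    exists2 z, (d p z <= r%:E)%E & (d z q <= (s - r)%:E)%E
}.

(** Forward Cauchy sequences converge. *)
Definition forward_complete (d : T -> T -> \bar R) : Prop :=
  forall u : nat -> T,
    (forall eps : R, 0 < eps -> exists N : nat, forall m k : nat,
      (N <= m)%N -> (m <= k)%N -> (d (u m) (u k) < eps%:E)%E) ->
    exists x : T, d (u i) x @[i --> \oo] --> 0%E.

(** [C] is a set of pairs of a time and a point that is compatible with being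
   part of the graph of a unit speed minimizer from [x] to [y] over [[0, D]].
   Only upper bounds on distances are required: when [d x y] is [D], the triangle
   inequality turns all of them into equalities. *)
Definition partial_minimizer (d : T -> T -> \bar R) (x y : T) (D : R)
    (C : set (R * T)) : Prop :=
  (forall u, C u -> [/\ 0 <= u.1 <= D, (d x u.2 <= u.1%:E)%E &
     (d u.2 y <= (D - u.1)%:E)%E]) /\
  (forall u v, C u -> C v -> u.1 <= v.1 -> (d u.2 v.2 <= (v.1 - u.1)%:E)%E).

Lemma le_dist_trans (d : T -> T -> \bar R) p q r (a b c : R) :
  asymmetric_length_space d -> (d p q <= a%:E)%E -> (d q r <= b%:E)%E ->
  a + b <= c -> (d p r <= c%:E)%E.
Proof.
move=> dH pq qr abc; apply: (le_trans (als_triangle dH p q r)).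
by apply: (le_trans (leeD pq qr)); rewrite -EFinD lee_fin.
Qed.

Lemma le_dist_eps (d : T -> T -> \bar R) p q (a : R) :
  (forall e, 0 < e -> (d p q <= (a + e)%:E)%E) -> (d p q <= a%:E)%E.
Proof. by move=> h; apply/lee_addgt0Pr => e e0; rewrite -EFinD; exact: h. Qed.

Lemma dist_eq0 (d : T -> T -> \bar R) p q : hausdorff_space T ->
  asymmetric_length_space d -> (d p q <= 0)%E -> p = q.
Proof.
move=> hT dH pq; apply: hT => A B /(als_sep dH)[e e0 eA] Bq.
exists q; split; last exact: nbhs_singleton Bq.
by apply: eA; left; apply: (le_lt_trans pq); rewrite lte_fin.
Qed.

Lemma exists_maximal_partial_minimizer d x y D :
  exists C, partial_minimizer d x y D C /\
    forall B, C `<` B -> ~ partial_minimizer d x y D B.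
Proof.
apply: Zorn_bigcup => F FP Ftot; split=> [u [C FC Cu]|u v [A FA Au] [B FB Bv]].
  by have [+ _] := FP _ FC; exact.
have [AB|BA] := Ftot _ _ FA FB.
- by have [_] := FP _ FB; apply => //; exact: AB.
- by have [_] := FP _ FA; apply => //; exact: BA.
Qed.

(** A pair that can be added to a maximal partial minimizer belongs to it. *)
Lemma maximal_partial_minimizer_mem d x y D C s p :
  asymmetric_length_space d ->
  partial_minimizer d x y D C ->
  (forall B, C `<` B -> ~ partial_minimizer d x y D B) ->
  0 <= s <= D -> (d x p <= s%:E)%E -> (d p y <= (D - s)%:E)%E ->
  (forall u, C u -> u.1 <= s -> (d u.2 p <= (s - u.1)%:E)%E) ->
  (forall u, C u -> s <= u.1 -> (d p u.2 <= (u.1 - s)%:E)%E) ->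
  C (s, p).
Proof.
move=> dH [C1 C2] Cmax sD xp py lo hi; apply: contrapT => nC.
apply: (Cmax (C `|` [set (s, p)])).
  split=> [|CC]; first by left.
  by apply: nC; apply: CC; right.
split=> [u [Cu|->]|u v [Cu|->] [Cv|->]] //=; first exact: C1.
- exact: C2.
- exact: lo.
- exact: hi.
- by rewrite (als_refl dH) subrr.
Qed.

Lemma maximal_partial_minimizer_ends d x y (D : R) C :
  hausdorff_space T ->
  asymmetric_length_space d -> d x y = D%:E ->
  partial_minimizer d x y D C ->
  (forall B, C `<` B -> ~ partial_minimizer d x y D B) ->
  C (0, x) /\ C (D, y).
Proof.
move=> hT dH dxy PC Cmax; have [C1 C2] := PC.
have D0 : 0 <= D by rewrite -lee_fin -dxy als_ge0.
split; apply: (maximal_partial_minimizer_mem dH PC Cmax).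
- by rewrite lexx.
- by rewrite als_refl.
- by rewrite subr0 dxy.
- move=> u Cu u0; have [/andP[u0' _] xu _] := C1 _ Cu.
  have u10 : u.1 = 0 by lra.
  by move: xu; rewrite u10 => /(dist_eq0 hT dH) <-; rewrite als_refl// subrr.
- by move=> u Cu _; have [_ xu _] := C1 _ Cu; rewrite subr0.
- by rewrite D0 lexx.
- by rewrite dxy.
- by rewrite als_refl// subrr.
- by move=> u /C1[_ _ ].
- move=> u Cu u0; have [/andP[_ u0'] _ uy] := C1 _ Cu.
  have u10 : u.1 = D by lra.
  move: uy; rewrite u10 subrr => /(dist_eq0 hT dH) ->.
  by rewrite als_refl.
Qed.

(** Forward completeness closes a maximal partial minimizer under suprema of
   times. Times have to be increasing along the sequence that is used, as only
   forward Cauchy sequences are known to converge. *)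
Lemma maximal_partial_minimizer_sup d x y (D : R) C (S : set R) :
  hausdorff_space T -> asymmetric_length_space d -> forward_complete d ->
  partial_minimizer d x y D C ->
  (forall B, C `<` B -> ~ partial_minimizer d x y D B) ->
  S `<=` [set s | exists p, C (s, p)] -> S !=set0 ->
  exists w, C (sup S, w).
Proof.
move=> hT dH dC PC Cmax SC S0; have [C1 C2] := PC.
have [SsupS|nS] := pselect (S (sup S)); first exact: SC.
have Sle s : S s -> 0 <= s <= D by move=> /SC[p /C1[]].
have hS : has_sup S by split=> //; exists D => s /Sle/andP[].
have Slt s : S s -> s < sup S.
  move=> Ss; rewrite lt_neqAle; apply/andP; split.
    by apply: contra_notN nS => /eqP <-.
  by apply: ub_le_sup => //; case: hS.
(* f tends to sup S inside S; its running maximum g is also nondecreasing *)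
have [f fP] : {f : nat -> R & forall k, S (f k) /\ sup S - k.+1%:R^-1 < f k}.
  apply: (@choice _ _ (fun (k : nat) (r : R) => S r /\ sup S - k.+1%:R^-1 < r)) => k.
  have k0 : 0 < k.+1%:R^-1 :> R by rewrite invr_gt0.
  by have [r Sr rk] := sup_adherent k0 hS; exists r.
pose g := fix g k := if k is k'.+1 then Num.max (g k') (f k) else f 0%N.
have gS k : S (g k).
  elim: k => [|k IH] /=; first by case: (fP 0%N).
  by rewrite maxEle; case: ifP => // _; case: (fP k.+1).
have fg k : f k <= g k by case: k => [|k] //=; rewrite le_max lexx orbT.
have gmono m k : (m <= k)%N -> g m <= g k.
  move=> /subnK <-; elim: (k - m)%N => [|j IH] //.
  by rewrite addSn /= (le_trans IH)// le_max lexx.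
have gsup (e : R) : 0 < e -> exists N, forall k, (N <= k)%N -> sup S - e < g k.
  move=> e0; exists (Num.truncn e^-1) => k Nk.
  apply: lt_le_trans (gmono _ _ Nk); apply: lt_le_trans (fg _).
  apply: le_lt_trans (proj2 (fP _)); rewrite lerD2l lerN2.
  rewrite invf_ple ?posrE ?invr_gt0//.
  by apply/ltW; rewrite truncnS_gt.
have [u uC] : {u : nat -> T & forall k, C (g k, u k)}.
  apply: (@choice _ _ (fun (k : nat) p => C (g k, p))) => k.
  by have [p] := SC _ (gS k); exists p.
have [|w uw] := dC u.
  move=> e /gsup[N NP]; exists N => m k Nm mk.
  apply: (le_lt_trans (C2 _ _ (uC m) (uC k) (gmono _ _ mk))).
  rewrite lte_fin /=; have := NP _ Nm; have := Slt _ (gS k); lra.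
have uw1 (e : R) : 0 < e -> exists N, forall k, (N <= k)%N -> (d (u k) w < e%:E)%E.
  move=> e0; have : \forall i \near \oo, (d (u i) w < e%:E)%E.
    apply: (uw [set z | (z < e%:E)%E]); apply: open_nbhs_nbhs; split.
      exact: open_ereal_lt_ereal.
    by rewrite /= lte_fin.
  by case=> N _ NP; exists N => k Nk; exact: NP.
have uw2 (e : R) : 0 < e -> exists N, forall k, (N <= k)%N ->
    (d w (u k) <= e%:E)%E /\ (d (u k) w <= e%:E)%E.
  move=> /(als_near dH w) /(als_sep dH)[e' e'0 e'P].
  have [N NP] := uw1 _ e'0; exists N => k Nk.
  by have [|h1 h2] := e'P (u k); [right; exact: NP|split; exact: ltW].
have both (e : R) : 0 < e -> exists k, [/\ sup S - e < g k,
     (d w (u k) <= e%:E)%E & (d (u k) w <= e%:E)%E].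
  move=> e0; have [N1 N1P] := gsup _ e0; have [N2 N2P] := uw2 _ e0.
  exists (maxn N1 N2); have [h1 h2] := N2P _ (leq_maxr N1 N2).
  by split=> //; apply: N1P; exact: leq_maxl.
exists w; apply: (maximal_partial_minimizer_mem dH PC Cmax).
- have [s Ss] := S0; have := Sle _ Ss; have := Slt _ Ss.
  have : sup S <= D by apply: ge_sup => // r /Sle/andP[].
  lra.
- apply: le_dist_eps => e e0; have [k [k1 k2 k3]] := both _ e0.
  have [_ xu _] := C1 _ (uC k).
  by apply: (le_dist_trans dH xu k3); have := Slt _ (gS k); rewrite /=; lra.
- apply: le_dist_eps => e e0; have [k [k1 k2 k3]] := both (e / 2) ltac:(lra).
  have [_ _ uy] := C1 _ (uC k).
  by apply: (le_dist_trans dH k2 uy); rewrite /=; lra.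
- move=> v Cv vS; apply: le_dist_eps => e e0.
  have [vS'|vS'] := ltP v.1 (sup S).
    have m0 : 0 < Num.min e (sup S - v.1) by rewrite lt_min e0 subr_gt0.
    have [k [k1 k2 k3]] := both _ m0.
    have vk : v.1 <= g k.
      have : Num.min e (sup S - v.1) <= sup S - v.1 by rewrite ge_min lexx orbT.
      lra.
    apply: (le_dist_trans dH (C2 _ _ Cv (uC k) vk) k3).
    have : Num.min e (sup S - v.1) <= e by rewrite ge_min lexx.
    by have := Slt _ (gS k); rewrite /=; lra.
  have /(dist_eq0 hT dH) <- : (d w v.2 <= 0)%E.
    apply: le_dist_eps => e' e'0.
    have [k [k1 k2 k3]] := both (e' / 2) ltac:(lra).
    have kv : g k <= v.1 by apply: le_trans vS'; apply/ltW/Slt.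
    by apply: (le_dist_trans dH k2 (C2 _ _ (uC k) Cv kv)) => /=; lra.
  by rewrite als_refl// lee_fin; lra.
- move=> v Cv vS; apply: le_dist_eps => e e0.
  have [k [k1 k2 k3]] := both (e / 2) ltac:(lra).
  have kv : g k <= v.1 by apply: le_trans vS; apply/ltW/Slt.
  by apply: (le_dist_trans dH k2 (C2 _ _ (uC k) Cv kv)) => /=; lra.
Qed.

(** A maximal partial minimizer has no gap. If the times below [s] have their
   supremum [sup S < s] attained at [w], choose [r < s - sup S] small enough for
   the forward ball of radius [r] around [w] to lie in a compact set. The points at distance
   at most [r] from [w] that are almost on the way from [w] to a later point of
   [C] form a filter base; a cluster point [z] is exactly on the way from [w] to
   all later points, and could be added to [C] at time [sup S + r]. Since the
   times above [s] may accumulate at their infimum without reaching it, all later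
   points have to be treated at once, and not only the next one. *)
Lemma maximal_partial_minimizer_total d x y (D : R) C :
  hausdorff_space T -> (forall p : T, exists2 U, nbhs p U & compact U) ->
  asymmetric_length_space d -> forward_complete d -> d x y = D%:E ->
  partial_minimizer d x y D C ->
  (forall B, C `<` B -> ~ partial_minimizer d x y D B) ->
  forall s, 0 <= s <= D -> exists p, C (s, p).
Proof.
move=> hT lcT dH dC dxy PC Cmax s sD; have [C1 C2] := PC.
have [C0x CDy] := maximal_partial_minimizer_ends hT dH dxy PC Cmax.
apply: contrapT => nCs.
pose S := [set r | r <= s /\ exists p, C (r, p)].
have S0 : S 0 by split; [lra|exists x].
have [w Cw] : exists w, C (sup S, w).
  by apply: (maximal_partial_minimizer_sup hT dH dC PC Cmax) => [r []//|]; exists 0.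
have hS : has_sup S by split; [exists 0|exists s => r []].
have Sub r : S r -> r <= sup S by move=> Sr; apply: ub_le_sup => //; case: hS.
have supS : sup S <= s by apply: ge_sup; [exists 0|move=> r []].
have {supS}supS : sup S < s.
  rewrite lt_neqAle supS andbT; apply: contra_notN nCs => /eqP <-; by exists w.
have supS0 : 0 <= sup S by exact: Sub.
have [U wU cU] := lcT w.
have [e e0 eU] := als_sep dH wU.
pose r := Num.min (e / 2) ((s - sup S) / 2).
have r0 : 0 < r by rewrite lt_min; apply/andP; split; lra.
have re : r < e.
  by have : r <= e / 2 by [rewrite ge_min lexx]; lra.
have rs : r < s - sup S.
  by have : r <= (s - sup S) / 2 by [rewrite ge_min lexx orbT]; lra.
pose I := [set i : (R * T) * R | [/\ C i.1, s <= i.1.1 & 0 < i.2]].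
pose B (i : (R * T) * R) := [set z | (d w z <= r%:E)%E /\
  (d z i.1.2 <= (i.1.1 - sup S - r + i.2)%:E)%E].
have ID : I ((D, y), 1) by split => //=; lra.
have FB : ProperFilter (filter_from I B).
  apply: filter_from_proper => [|[[t q] f] [/= Cq st f0]]; last first.
    have [||z wz zq] := als_split dH (p := w) (q := q) (r := r) (s := t - sup S + f).
    - apply: (le_lt_trans (C2 _ _ Cw Cq _)) => /=; first lra.
      by rewrite lte_fin; lra.
    - lra.
    exists z; split=> //=; apply: (le_trans zq); rewrite lee_fin; lra.
  apply: filter_from_filter; first by exists ((D, y), 1).
  move=> [u f] [v g] [/= Cu su f0] [/= Cv sv g0].
  (* by the triangle inequality, the condition that an earlier point of C gives
     implies the one that a later point gives *)
  wlog uv : u v f g Cu su Cv sv f0 g0 / u.1 <= v.1 => [wl|].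
    have [uv|/ltW vu] := leP u.1 v.1; first exact: wl.
    by have [k Ik Bk] := wl _ _ _ _ Cv sv Cu su g0 f0 vu; exists k => //; rewrite setIC.
  exists (u, Num.min f g); first by split => //=; rewrite lt_min f0.
  have mf : Num.min f g <= f by rewrite ge_min lexx.
  have mg : Num.min f g <= g by rewrite ge_min lexx orbT.
  move=> z [/= wz zu]; split; split=> //=.
    by apply: (le_trans zu); rewrite lee_fin; lra.
  by apply: (le_dist_trans dH zu (C2 _ _ Cu Cv uv)); lra.
have [|z [_ zcl]] := cU _ FB.
  exists ((D, y), 1) => // z [/= wz _]; apply: eU; left.
  by apply: (le_lt_trans wz); rewrite lte_fin.
have zP (e' : R) i : 0 < e' -> I i ->
    exists z', B i z' /\ (d z z' <= e'%:E)%E /\ (d z' z <= e'%:E)%E.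
  move=> e'0 Ii; have [|z' [Bz' [h1 h2]]] := zcl (B i) _ _ (als_near dH z e'0).
    by exists i.
  by exists z'; split=> //; split; exact: ltW.
have wz : (d w z <= r%:E)%E.
  apply: le_dist_eps => f f0; have [z' [[wz' _] [_ z'z]]] := zP _ _ f0 ID.
  exact: (le_dist_trans dH wz' z'z).
have zC u : C u -> s <= u.1 -> (d z u.2 <= (u.1 - (sup S + r))%:E)%E.
  move=> Cu su; apply: le_dist_eps => f f0.
  have [||z' [[_ /= z'u] [zz' _]]] := zP (f / 2) (u, f / 2).
  - lra.
  - by split => //=; lra.
  by apply: (le_dist_trans dH zz' z'u) => /=; lra.
have Cz : C (sup S + r, z).
  apply: (maximal_partial_minimizer_mem dH PC Cmax).
  - lra.
  - have [_ xw _] := C1 _ Cw; exact: (le_dist_trans dH xw wz).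
  - by apply: (zC _ CDy); rewrite /=; lra.
  - move=> u Cu usr.
    have us : u.1 <= sup S.
      by apply: Sub; split; [lra|exists u.2; case: (u) Cu].
    by apply: (le_dist_trans dH (C2 _ _ Cu Cw us) wz) => /=; lra.
  - move=> u Cu usr; apply: zC => //; rewrite leNgt; apply/negP => us.
    have : u.1 <= sup S by apply: Sub; split; [lra|exists u.2; case: (u) Cu].
    lra.
have : sup S + r <= sup S by apply: Sub; split; [lra|exists z].
lra.
Qed.

(** Hopf-Rinow theorem: points at finite distance are joined by a minimizer,
   parametrized by the distance from its origin. *)
Theorem exists_minimizer d x y (D : R) :
  hausdorff_space T -> (forall p : T, exists2 U, nbhs p U & compact U) ->
  asymmetric_length_space d -> forward_complete d -> d x y = D%:E ->
  exists sigma : R -> T, [/\ sigma 0 = x, sigma D = y &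
    forall s t, 0 <= s -> s <= t -> t <= D ->
      d (sigma s) (sigma t) = (t - s)%:E].
Proof.
move=> hT lcT dH dC dxy.
have D0 : 0 <= D by rewrite -lee_fin -dxy als_ge0.
have [C [PC Cmax]] := exists_maximal_partial_minimizer d x y D.
have Ctot := maximal_partial_minimizer_total hT lcT dH dC dxy PC Cmax.
have [C0x CDy] := maximal_partial_minimizer_ends hT dH dxy PC Cmax.
have [C1 C2] := PC.
have [sigma sP] : {sigma : R -> T & forall s, 0 <= s <= D -> C (s, sigma s)}.
  apply: (@choice _ _ (fun s p => 0 <= s <= D -> C (s, p))) => s.
  have [/Ctot[p Cp]|/negP ns] := boolP (0 <= s <= D); first by exists p.
  by exists x.
have Cinj s p q : C (s, p) -> C (s, q) -> p = q.
  move=> Cp Cq; apply: (dist_eq0 hT dH).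
  by have := C2 _ _ Cp Cq (lexx _); rewrite subrr.
exists sigma; split.
- by apply: Cinj C0x; apply: sP; lra.
- by apply: Cinj CDy; apply: sP; lra.
- move=> s t s0 st tD.
  have Cs := sP s ltac:(lra); have Ct := sP t ltac:(lra).
  have le1 := C2 _ _ Cs Ct st; have [_ xs _] := C1 _ Cs; have [_ _ ty] := C1 _ Ct.
  apply/eqP; rewrite eq_le le1 /= leNgt; apply/negP => lt1.
  have dfin : (d (sigma s) (sigma t) \is a fin_num).
    by rewrite ge0_fin_numE ?als_ge0// (lt_trans lt1)// ltry.
  have st' := fineK dfin; rewrite -st' lte_fin in lt1.
  have : (d x y <= (s + fine (d (sigma s) (sigma t)) + (D - t))%:E)%E.
    apply: (le_dist_trans dH _ ty (lexx _)).
    by apply: (le_dist_trans dH xs _ (lexx _)); rewrite st'.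
  by rewrite dxy lee_fin; lra.
Qed.

End AsymmetricLengthSpace.

(** * Functions of a real variable *)

Lemma within_dnbhs_itv (R : realType) (A : set R) (c d t : R) :
  c < t < d -> `]c, d[ `<=` A -> within A t^' = t^'.
Proof.
move=> ctd cdA; apply/funext => P; apply/propext; split; last first.
  exact: cvg_within.
rewrite /within /= /dnbhs /within /= => h.
have {}h : \forall s \near t, s != t -> A s -> P s := h.
have h' : \forall s \near t, s \in `]c, d[ by apply: near_in_itvoo; rewrite in_itv.
suff : \forall s \near t, s != t -> P s by [].
by apply: filterS2 h h' => s h1 h2 st; apply: h1 => //; exact: cdA.
Qed.

Lemma proper_within_dnbhs_itv (R : realType) (c d t : R) : c < d ->
  c <= t <= d -> ProperFilter (within `[c, d] t^').
Proof.
move=> cd ctd; apply: Build_ProperFilter_ex => P.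
rewrite /within /dnbhs /within /= => h.
have {}h : \forall s \near t, s != t -> s \in `[c, d] -> P s := h.
move: h => /nbhs_ballP[e /= e0 eP].
have min_e x : Num.min (e / 2) x <= e / 2 by rewrite ge_min lexx.
have min_x x : Num.min (e / 2) x <= x by rewrite ge_min lexx orbT.
have [td|dt] := ltP t d.
- have := min_e (d - t); have := min_x (d - t).
  have : 0 < Num.min (e / 2) (d - t) by rewrite lt_min; apply/andP; split; lra.
  set m := Num.min _ _ => m0 m1 m2.
  exists (t + m); apply: eP; rewrite /= /ball /=.
  + by rewrite opprD addNKr normrN gtr0_norm//; lra.
  + by apply/eqP; lra.
  + by rewrite in_itv /=; lra.
- have := min_e (t - c); have := min_x (t - c).
  have : 0 < Num.min (e / 2) (t - c) by rewrite lt_min; apply/andP; split; lra.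
  set m := Num.min _ _ => m0 m1 m2.
  exists (t - m); apply: eP; rewrite /= /ball /=.
  + by rewrite opprB addrC subrK gtr0_norm//; lra.
  + by apply/eqP; lra.
  + by rewrite in_itv /=; lra.
Qed.

Lemma within_eq_cvg (R : realType) (A : set R) (F : set_system R) (T : Type)
    (f g : R -> T) (G : set_system T) : Filter F -> (forall s, A s -> f s = g s) ->
  f s @[s --> within A F] --> G -> g s @[s --> within A F] --> G.
Proof.
move=> FF fg; apply: cvg_trans; apply: near_eq_cvg.
by rewrite /prop_near1 /nbhs /= /within /=; apply: nearW => s As; rewrite fg.
Qed.

Lemma cvg_shift_within (R : realType) (c d h t : R) :
  s - h @[s --> within `[c + h, d + h] t^'] --> within `[c, d] (t - h)^'.
Proof.
move=> P; rewrite /within /dnbhs /within /= => H.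
have {}H : \forall s \near t - h, s != t - h -> s \in `[c, d] -> P s := H.
suff : \forall s \near t, s != t -> s \in `[c + h, d + h] -> P (s - h) by [].
move: H => /nbhs_ballP[e /= e0 eP]; apply/nbhs_ballP; exists e => //= s.
rewrite /ball /= => ts st; rewrite in_itv /= => sc; apply: eP.
- by rewrite /ball /= opprB addrA subrK.
- by apply: contra_neq st => st; lra.
- by rewrite in_itv /=; lra.
Qed.

Section RealLemmas.
Context {R : realType}.
Local Notation mu := (@lebesgue_measure R).

(** Real induction: an interval predicate that is additive and holds on all
   short intervals around each point holds on the whole interval. *)
Lemma segment_induction (a b : R) (P : R -> R -> Prop) : a <= b ->
  (forall s t u, a <= s -> s <= t -> t <= u -> u <= b -> P s t -> P t u -> P s u) ->
  (forall x, a <= x <= b -> exists2 e, 0 < e & forall s t,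
    a <= s -> s <= t -> t <= b -> `|s - x| < e -> `|t - x| < e -> P s t) ->
  P a b.
Proof.
move=> ab Padd Ploc.
pose S := [set t | a <= t <= b /\ P a t].
have Sa : S a.
  have [|e e0 eP] := Ploc a; first by rewrite lexx.
  by split; [rewrite lexx|apply: eP; rewrite ?lexx ?subrr ?normr0].
have hS : has_sup S by split; [exists a|exists b => t [/andP[]]].
have aS : a <= sup S by apply: ub_le_sup => //; case: hS.
have Sb : sup S <= b by apply: ge_sup; [exists a|move=> t [/andP[]]].
have [|e e0 eP] := Ploc (sup S); first by rewrite aS.
have [s [sab Ps] es] := sup_adherent e0 hS.
have sS : s <= sup S by apply: ub_le_sup => //; case: hS.
pose u := Num.min b (sup S + e / 2).
have ub : u <= b by rewrite ge_min lexx.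
have ue : u <= sup S + e / 2 by rewrite ge_min lexx orbT.
have Su : sup S <= u by rewrite le_min Sb /=; lra.
have Pu : P a u.
  apply: (Padd a s u) => //; [lra|lra|].
  by apply: eP => //; [lra|lra|rewrite ltr_norml; lra|rewrite ltr_norml; lra].
have uS : u <= sup S by apply: ub_le_sup; [case: hS|split => //; lra].
have bu : b <= u.
  have : (b <= u) || (sup S + e / 2 <= u) by rewrite /u !le_min !lexx /= andbT le_total.
  by case/orP => //; lra.
by have -> : b = u by apply/le_anti; rewrite bu ub.
Qed.

Lemma within_itv_continuous (f : R -> R) (a b x : R) :
  {within `[a, b], continuous f} -> a < x < b -> {for x, continuous f}.
Proof.
move=> fc axb; have : {within `]a, b[, continuous f}.
  by apply: continuous_subspaceW fc; apply: subset_itv; rewrite bnd_simp.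
rewrite continuous_open_subspace; last exact: interval_open.
by apply; rewrite inE /= in_itv.
Qed.

(** Mean value inequality. *)
Lemma le_integral_derive (k h : R -> R) (a b : R) : a <= b ->
  {within `[a, b], continuous h} -> {within `[a, b], continuous k} ->
  (forall x, a < x < b -> derivable k x 1 /\ `|derive1 k x| <= h x) ->
  `|k b - k a| <= \int[mu]_(x in `[a, b]) h x.
Proof.
move=> ab hc kc kd.
have hi : mu.-integrable `[a, b] (EFin \o h).
  by apply: continuous_compact_integrable => //; exact: segment_compact.
pose H x := \int[mu]_(t in `[a, x]) h t.
have Hc : {within `[a, b], continuous H} by exact: parameterized_integral_continuous.
have Hd x : a < x < b -> derivable H x 1 /\ derive1 H x = h x.
  move=> /andP[ax xb]; apply: (continuous_FTC1_closed xb) => //.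
  by apply: within_itv_continuous hc _; rewrite ax.
have Ha : H a = 0 by rewrite /H set_itv1 Rintegral_set1.
have mono (l : R -> R) : {within `[a, b], continuous l} ->
    (forall x, a < x < b -> derivable l x 1 /\ `|derive1 l x| <= h x) ->
    l a <= l b + H b.
  move=> lc ld; have <- : l a + H a = l a by rewrite Ha addr0.
  apply: (@ger0_derive1_le_cc _ (l \+ H) a b); rewrite ?in_itv /= ?lexx ?ab //.
  - move=> x; rewrite in_itv /= => xab.
    by apply: derivableD; [exact: (ld x xab).1|exact: (Hd x xab).1].
  - move=> x; rewrite in_itv /= => xab.
    rewrite derive1E deriveD; [|exact: (ld x xab).1|exact: (Hd x xab).1].
    rewrite -!derive1E (Hd x xab).2; have := (ld x xab).2; rewrite ler_norml; lra.
  - by move=> x; apply: cvgD; [exact: lc|exact: Hc].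
have := mono k kc kd.
have : - k a <= - k b + H b.
  apply: (mono (\- k)).
  - by move=> x; apply: cvgN; exact: kc.
  - move=> x xab; have [kx kh] := kd x xab; split; first exact: derivableN.
    by rewrite derive1E deriveN// -derive1E normrN.
rewrite -/(H b) ler_norml; lra.
Qed.

End RealLemmas.

Lemma coord_le_norm (R : realType) n (v : 'rV[R]_n) j : `|v 0 j| <= `|v|.
Proof.
by rewrite [leRHS]/Num.norm /= mx_normrE; apply/bigmax_geP; right => /=; exists (0, j).
Qed.

Lemma norm_le_coord (R : realType) n (v : 'rV[R]_n) m : 0 <= m ->
  (forall j, `|v 0 j| <= m) -> `|v| <= m.
Proof.
move=> m0 vm; rewrite [leLHS]/Num.norm /= mx_normrE; apply/bigmax_leP; split => //.
by move=> [i j] _ /=; rewrite ord1.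
Qed.

Lemma derive1_quotient (R : realType) (k : R -> R) (x l : R) :
  (s - x)^-1 * (k s - k x) @[s --> x^'] --> l ->
  derivable k x 1 /\ derive1 k x = l.
Proof.
move=> kl.
have sub : h + x @[h --> (0 : R)^'] --> x^'.
  move=> P; rewrite /dnbhs /within /= => H.
  have {}H : \forall s \near x, s != x -> P s := H.
  suff : \forall s \near (0 : R), s != 0 -> P (s + x) by [].
  have sh : (fun s : R => s + x) @ (0 : R) --> x.
    by rewrite -[X in _ --> X]add0r; apply: cvgD; [exact: cvg_id|exact: cvg_cst].
  have : \forall s \near (0 : R), s + x != x -> P (s + x) := sh _ H.
  by apply: filterS => s h s0; apply: h; apply: contra_neq s0 => h; lra.
have h := cvg_comp _ _ sub kl.
have kd : h^-1 *: (k (h *: 1 + x) - k x) @[h --> (0 : R)^'] --> l.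
  apply: cvg_trans h; apply: near_eq_cvg; apply: nearW => s /=.
  by rewrite addrK [_ *: 1]mulr1.
split; first by rewrite /derivable; apply/cvg_ex; exists l.
by rewrite derive1E /derive; apply: cvg_lim.
Qed.

(** * Row vectors and differentials *)

Lemma compact_norm_ball (R : realType) n (q : 'rV[R]_n) (r : R) :
  compact [set q' : 'rV[R]_n | `|q' - q| <= r].
Proof.
apply: bounded_closed_compact.
  exists (`|q| + r); split; first exact: num_real.
  move=> x xr q' /= q'r; apply: le_trans (ltW xr).
  by rewrite -[q'](subrK q) (le_trans (ler_normD _ _))// addrC lerD2l.
have -> : [set q' : 'rV[R]_n | `|q' - q| <= r] = closed_ball_ Num.norm q r.
  by apply/funext => q' /=; rewrite /closed_ball_ /= distrC.
exact: closed_closed_ball_.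
Qed.

Lemma compact_norm_sphere (R : realType) n : compact [set v : 'rV[R]_n | `|v| = 1].
Proof.
apply: (@subclosed_compact _ _ [set v : 'rV[R]_n | `|v - 0| <= 1]).
- rewrite -[X in closed X]/((@Num.norm _ 'rV[R]_n) @^-1` [set x : R | x = 1]).
  apply: preimage_closed.
  + by move=> v _; exact: norm_continuous.
  + exact: (@closed_eq R 1).
- exact: compact_norm_ball.
- by move=> v /=; rewrite subr0 => ->.
Qed.

Section Differentials.
Context {R : realType} {V W : normedModType R}.

(** The directional derivative, with an increment [s - t] of the time. *)
Lemma diff_quotient_cvg (f : V -> W) (a w : V) (t : R) : differentiable f a ->
  (s - t)^-1 *: (f (a + (s - t) *: w) - f a) @[s --> t^'] --> 'd f a w.
Proof.
move=> fa; rewrite -deriveE//.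
have sub : s - t @[s --> t^'] --> (0 : R)^'.
  move=> P; rewrite /dnbhs /within /= => H.
  have {}H : \forall s \near (0 : R), s != 0 -> P s := H.
  suff : \forall s \near t, s != t -> P (s - t) by [].
  have sh : (fun s : R => s - t) @ t --> (0 : R).
    by rewrite -[X in _ --> X](subrr t); apply: cvgB; [exact: cvg_id|exact: cvg_cst].
  have : \forall s \near t, s - t != 0 -> P (s - t) := sh _ H.
  by apply: filterS => s; rewrite subr_eq0.
have := diff_derivable (v := w) fa; rewrite /derivable /derive => cv.
have := cvg_comp _ _ sub cv; apply: cvg_trans; apply: near_eq_cvg.
by apply: nearW => s /=; rewrite [_ *: w + a]addrC.
Qed.

Lemma near_eq_diff (f g : V -> W) (a w : V) :
  differentiable f a -> differentiable g a -> {near a, f =1 g} ->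
  'd f a w = 'd g a w.
Proof.
move=> fa ga fg.
have cf := @diff_quotient_cvg f a w 0 fa; have cg := @diff_quotient_cvg g a w 0 ga.
suff cfg : (s - 0)^-1 *: (f (a + (s - 0) *: w) - f a) @[s --> (0 : R)^'] --> 'd g a w.
  exact: (cvg_unique _ cf cfg).
apply: cvg_trans cg; apply: near_eq_cvg.
have line : (fun s : R => a + (s - 0) *: w) @ (0 : R) --> a.
  rewrite -[X in _ --> X]addr0 -[X in _ + X](scale0r w).
  apply: cvgD; first exact: cvg_cst.
  apply: cvgZr_tmp; rewrite -[X in _ --> X](subrr 0).
  by apply: cvgB; [exact: cvg_id|exact: cvg_cst].
have h : \forall s \near (0 : R), f (a + (s - 0) *: w) = g (a + (s - 0) *: w).
  exact: line fg.
apply: cvg_within; apply: filterS h => s /= ->.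
by rewrite (nbhs_singleton fg).
Qed.

End Differentials.

(** * C^1 paths and their velocities *)

Section Lifts.
Context {R : realType} {n : nat} {M : smooth_manifold R n}.

Lemma tvecP (u : tangent_bundle M) x : projT1 u = x ->
  exists v : tangent x, u = tvec v.
Proof. by case: u => y v /= <-; exists v. Qed.

Lemma tangent_inj (x : M) (v w : tangent x) :
  (forall i, chart_dom i x -> tangent_val v i = tangent_val w i) -> v = w.
Proof.
case: v w => [v vT] [w wT] /= vw; apply: val_inj => /=; apply/funext => i.
have [xi|nxi] := pselect (chart_dom i x); first exact: vw.
move: vT wT => /asboolP[v0 _] /asboolP[w0 _].
by rewrite v0// w0.
Qed.

Lemma has_velocity_unique (c d t : R) (beta : R -> M) (v w : tangent (beta t)) :
  c < d -> c <= t <= d ->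
  has_velocity `[c, d] v -> has_velocity `[c, d] w -> v = w.
Proof.
move=> cd tcd vv vw; apply: tangent_inj => i xi.
have FF := proper_within_dnbhs_itv cd tcd.
exact: (cvg_unique _ (vv i xi) (vw i xi)).
Qed.

(** [W] is a C^1 path over [[c, d]] together with its velocity: over that
   interval, the vector [W t] is the velocity at time [t] of the path of base
   points of [W]. As the base point is part of [W t], the statements below are
   free of the dependent type of the velocity. *)
Definition C1_lift (c d : R) (W : R -> tangent_bundle M) : Prop :=
  (forall t, c <= t <= d -> forall i, chart_dom i (projT1 (W t)) ->
    (s - t)^-1 *: (chart i (projT1 (W s)) - chart i (projT1 (W t)))
      @[s --> within `[c, d] t^'] --> tangent_val (projT2 (W t)) i) /\
  {within `[c, d], continuous W}.

Lemma C1_path_lift c d (beta : R -> M) : C1_path c d beta ->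
  exists2 W, C1_lift c d W & forall t, projT1 (W t) = beta t.
Proof. by move=> [V [VP Vc]]; exists (fun t => tvec (V t)) => //; split. Qed.

Lemma C1_lift_path c d (beta : R -> M) W : c <= d -> C1_lift c d W ->
  (forall t, c <= t <= d -> projT1 (W t) = beta t) -> C1_path c d beta.
Proof.
move=> cd [WP Wc] Wb.
(* outside [c, d] the velocity is irrelevant, and set to 0 *)
have [V VP] : {V : forall t, tangent (beta t) & forall t, c <= t <= d ->
    W t = tvec (V t)}.
  have /all_tag[V VP] : forall t, {v : tangent (beta t) | c <= t <= d ->
      W t = tvec v}.
    move=> t; apply: constructive_indefinite_description.
    have [tcd|/negP nt] := boolP (c <= t <= d).
      by have [v ->] := tvecP (Wb _ tcd); exists v.
    by exists 0.
  by exists V.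
exists V; split.
- move=> t tcd i xi; have := WP t tcd i; rewrite (VP _ tcd) /= => /(_ xi).
  apply: within_eq_cvg => s; rewrite /= in_itv /= => sA; by rewrite Wb.
- apply: subspace_eq_continuous Wc => t /set_mem; rewrite /= in_itv /= => tcd.
  exact: VP.
Qed.

Lemma C1_liftS c d c' d' W : c <= c' -> d' <= d -> C1_lift c d W -> C1_lift c' d' W.
Proof.
move=> cc' dd' [WP Wc].
have sub : `[c', d']%classic `<=` `[c, d] by apply: subset_itv; rewrite bnd_simp.
split; last exact: continuous_subspaceW Wc.
move=> t tcd i ti; apply: cvg_trans (WP t _ i ti); last by lra.
apply: cvg_fmap2; exact: within_subset.
Qed.

(** Inside a C^1 piece, [velocity] is the velocity of that piece; at its ends it
   may be the default value 0. *)
Lemma velocityE (a b c d t : R) (beta : R -> M) W : C1_lift c d W ->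
  (forall s, c <= s <= d -> projT1 (W s) = beta s) ->
  a <= c -> d <= b -> c < t < d -> tvec (velocity `[a, b] beta t) = W t.
Proof.
move=> [WP _] Wb ac db ctd; have tcd : c <= t <= d by lra.
have [v vE] := tvecP (Wb _ tcd); rewrite vE; congr tvec.
have vv : has_velocity `[a, b] v.
  move=> i xi; have := WP t tcd i; rewrite vE /= => /(_ xi).
  rewrite !(@within_dnbhs_itv _ _ c d)//; last 2 first.
  - by apply: subset_itv; rewrite bnd_simp.
  - by apply: subset_itv; rewrite bnd_simp.
  apply: cvg_trans; apply: near_eq_cvg.
  have h' : \forall s \near t, s \in `]c, d[ by apply: near_in_itvoo; rewrite in_itv.
  apply: cvg_within; apply: filterS h' => s; rewrite in_itv /= => sA.
  by rewrite Wb//; lra.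
rewrite /velocity; apply: xget_unique => // w ww.
by apply: has_velocity_unique ww vv; lra.
Qed.

Lemma projT1_tangent_continuous : continuous (fun u : tangent_bundle M => projT1 u).
Proof.
apply/continuousP => U oU; rewrite /open /= => i.
exists (fst @^-1` (chart i @` (chart_dom i `&` U))).
  apply: open_comp => [u _|]; first exact: cvg_fst.
  have -> : chart i @` (chart_dom i `&` U) =
      chart i @` (chart_dom i) `&` chart_inv i @^-1` U.
    apply/seteqP; split => [_ [x [xi Ux] <-]|_ [[x xi <-]]].
      by split; [exists x|rewrite /= chartK].
    by rewrite /= chartK// => Ux; exists x.
  rewrite openE => p [pi Up]; apply: filterI.
    by apply: open_nbhs_nbhs; split => //; exact: chart_image_open.
  by apply: (chart_inv_continuous pi); apply: open_nbhs_nbhs; split.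
move=> u ui; split => [Uu|[x [xi Ux] xE]].
  by exists (projT1 u).
by rewrite /preimage /= -(chartK ui) -[chart i _]xE chartK.
Qed.

End Lifts.

(** * Length of piecewise C^1 paths *)

Section Length.
Context {R : realType} {n : nat} {M : smooth_manifold R n} (F : finsler M).
Local Notation mu := (@lebesgue_measure R).

(** The length of the base path of [W], as a real number. *)
Definition lift_length (c d : R) (W : R -> tangent_bundle M) : R :=
  (\int[mu]_(s in `[c, d]) F (W s))%R.

Lemma finsler_lift_continuous c d W : C1_lift c d W ->
  {within `[c, d], continuous (fun s => F (W s))}.
Proof.
move=> [_ Wc] t; have Ft := @finsler_continuous _ _ _ F (W t).
exact: (@continuous_comp _ _ _ (W : subspace `[c, d] -> _) F t (Wc t) Ft).
Qed.

Lemma finsler_lift_integrable c d W : C1_lift c d W ->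
  mu.-integrable `[c, d] (EFin \o (fun s => F (W s))).
Proof.
move=> /finsler_lift_continuous WF.
by apply: continuous_compact_integrable => //; exact: segment_compact.
Qed.

Lemma lift_lengthE c d W : C1_lift c d W ->
  (lift_length c d W)%:E = (\int[mu]_(s in `[c, d]) (F (W s))%:E)%E.
Proof.
move=> Wl; rewrite /lift_length /Rintegral fineK//.
apply: integrable_fin_num => //; exact: finsler_lift_integrable.
Qed.

Lemma lift_length_ge0 c d W : 0 <= lift_length c d W.
Proof. by apply: Rintegral_ge0 => s _; exact: finsler_ge0. Qed.

Lemma lift_lengthD c e d W : c <= e <= d -> C1_lift c d W ->
  lift_length c d W = lift_length c e W + lift_length e d W.
Proof.
move=> /andP[ce ed] /finsler_lift_integrable Wi; rewrite /lift_length.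
have sub : `]e, d]%classic `<=` `[c, d] by apply: subset_itv; rewrite bnd_simp.
rewrite -[X in _ = _ + X]Rintegral_itv_obnd_cbnd; last first.
  exact: integrableS Wi.
by rewrite -(Rintegral_itvB (x := e) Wi) ?bnd_simp// addrC subrK.
Qed.

Lemma lift_length0 c W : lift_length c c W = 0.
Proof. by rewrite /lift_length set_itv1 Rintegral_set1. Qed.

(** Over [[a, b]], the path [beta] is a succession of C^1 pieces of total length
   [L]. *)
Inductive C1_pieces (beta : R -> M) : R -> R -> R -> Prop :=
| C1_pieces_nil a : C1_pieces beta a a 0
| C1_pieces_cons a c b W L : a < c -> C1_lift a c W ->
    (forall t, a <= t <= c -> projT1 (W t) = beta t) ->
    C1_pieces beta c b L -> C1_pieces beta a b (lift_length a c W + L).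

Lemma C1_pieces_le beta a b L : C1_pieces beta a b L -> a <= b.
Proof. by elim=> // *; lra. Qed.

Lemma C1_pieces_piecewise beta a b L :
  C1_pieces beta a b L -> piecewise_C1_path a b beta.
Proof.
elim=> {a b L}[a|a c b W L ac Wl Wb _ [s [sp sl] IH]].
  by exists [::] => //; split => /=.
exists (c :: s); first by split=> //=; rewrite ac.
move=> [_|k ks] /=; first exact: C1_lift_path (ltW ac) Wl Wb.
exact: IH.
Qed.

Lemma piecewise_C1_pieces beta a b :
  piecewise_C1_path a b beta -> exists L, C1_pieces beta a b L.
Proof.
move=> [s]; elim: s a => [a [_ /eqP /= <-] _|c s IH a [/= /andP[ac cs] sl] P].
  by exists 0; constructor.
have [L LP] := IH c (conj cs sl) (fun k => P k.+1).
have [W Wl Wb] := C1_path_lift (P 0%N isT).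
by exists (lift_length a c W + L); apply: C1_pieces_cons => // t _.
Qed.

(** The endpoints of the pieces, where [velocity] may take the value 0, form a
   null set, so that they do not contribute to the length. *)
Lemma C1_pieces_integral a0 b0 beta a b L : C1_pieces beta a b L ->
  a0 <= a -> b <= b0 ->
  let g s := F (tvec (velocity `[a0, b0] beta s)) in
  measurable_fun `[a, b] g /\ (\int[mu]_(s in `[a, b]) (g s)%:E = L%:E)%E.
Proof.
move=> + + + g; elim=> {a b L}[a|a c b W L ac Wl Wb P IH] a0a bb0.
  rewrite set_itv1; split; first exact: measurable_fun_set1.
  by rewrite integral_set1.
have cb := C1_pieces_le P.
have [mg gL] := IH ltac:(lra) bb0.
have gW : {in `]a, c[, (fun s => F (W s)) =1 g}.
  by move=> s; rewrite in_itv /= => sac; rewrite /g (velocityE Wl Wb)//; lra.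
have mW : measurable_fun `[a, c] (fun s => F (W s)).
  have /integrableP[+ _] := finsler_lift_integrable Wl.
  by move=> /measurable_EFinP.
have mWo : measurable_fun `]a, c[ (fun s => F (W s)).
  by apply: measurable_funS mW => //; apply: subset_itv; rewrite bnd_simp.
have mgo : measurable_fun `]a, c[ g.
  by apply: eq_measurable_fun mWo => s /set_mem /=; exact: gW.
have mgc : measurable_fun `[a, c] g by exact: measurable_fun_itv_cc mgo.
have abE : `[a, b]%classic = `[a, c]%classic `|` `]c, b]%classic.
  by rewrite -itv_bndbnd_setU ?bnd_simp// ltW.
have mgcb : measurable_fun `]c, b] g.
  by apply: measurable_funS mg => //; apply: subset_itv; rewrite bnd_simp.
have mgab : measurable_fun (`[a, c]%classic `|` `]c, b]%classic) g.
  by apply/measurable_funU.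
rewrite abE; split => //.
rewrite ge0_integral_setU//=; last 3 first.
- exact/measurable_EFinP.
- by move=> s _; rewrite lee_fin finsler_ge0.
- by apply/disj_setPS => s; rewrite /= !in_itv /=; lra.
rewrite EFinD lift_lengthE//; congr (_ + _)%E.
  by apply: eq_integral_itv_bounded => // s sac; rewrite gW.
by rewrite -gL integral_itv_obnd_cbnd//; exact/measurable_EFinP.
Qed.

Lemma C1_pieces_length beta a b L : C1_pieces beta a b L ->
  finsler_length F a b beta = L%:E.
Proof. by move=> /C1_pieces_integral -/(_ a b (lexx _) (lexx _))[]. Qed.

End Length.

(** * The Finsler distance as an infimum over chains of C^1 paths *)

Section Chains.
Context {R : realType} {n : nat} {M : smooth_manifold R n} (F : finsler M).
Local Notation mu := (@lebesgue_measure R).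

Lemma C1_pieces_eq (beta beta' : R -> M) a b L :
  (forall t, a <= t <= b -> beta t = beta' t) ->
  C1_pieces F beta a b L -> C1_pieces F beta' a b L.
Proof.
move=> + P; elim: P => {a b L}[a _|a c b W L ac Wl Wb P IH bb]; first by constructor.
have cb := C1_pieces_le P; constructor => //.
- by move=> t tac; rewrite Wb// bb//; lra.
- by apply: IH => t tcb; apply: bb; lra.
Qed.

Lemma C1_lift_shift (h c d : R) (W : R -> tangent_bundle M) : C1_lift c d W ->
  C1_lift (c + h) (d + h) (fun t => W (t - h)).
Proof.
move=> [WP Wc]; split.
  move=> t tcd i ti; have tcd' : c <= t - h <= d by lra.
  have := cvg_comp _ _ (@cvg_shift_within R c d h t) (WP (t - h) tcd' i ti).
  apply: cvg_trans; apply: near_eq_cvg.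
  by apply: nearW => s /=; rewrite opprB addrA subrK.
apply/subspace_continuousP => t; rewrite /= in_itv /= => tcd.
have tcd' : `[c, d]%classic (t - h) by rewrite /= in_itv /=; lra.
apply: cvg_comp (proj1 (subspace_continuousP _ _) Wc (t - h) tcd') => P.
rewrite /within /= => H.
have {}H : \forall s \near t - h, s \in `[c, d] -> P s := H.
suff : \forall s \near t, s \in `[c + h, d + h] -> P (s - h) by [].
have : \forall s \near t, s - h \in `[c, d] -> P (s - h).
  have sh : (fun s : R => s - h) @ t --> t - h.
    by apply: cvgB; [exact: cvg_id|exact: cvg_cst].
  exact: sh H.
apply: filterS => s sP; rewrite in_itv /= => scd; apply: sP.
by rewrite in_itv /=; lra.
Qed.

Lemma lift_length_shift (h c d : R) (W : R -> tangent_bundle M) : c < d ->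
  C1_lift c d W ->
  lift_length F (c + h) (d + h) (fun t => W (t - h)) = lift_length F c d W.
Proof.
move=> cd Wl; apply: EFin_inj; rewrite !lift_lengthE//; last exact: C1_lift_shift.
have dF (x : R) : is_derive x 1 (fun t : R => t - h) 1.
  by rewrite -[X in is_derive _ _ _ X]subr0; exact: is_deriveB.
have F'E : derive1 (fun t : R => t - h) = cst 1.
  by apply/funext => x; rewrite derive1E (@derive_val _ _ _ _ _ _ _ (dF x)).
have shc (x : R) : (fun t : R => t - h) y @[y --> x] --> x - h.
  by apply: cvgB; [exact: cvg_id|exact: cvg_cst].
have := @integration_by_substitution_increasing R (fun t => t - h) (fun s => F (W s))
  (c + h) (d + h).
rewrite F'E !addrK => ->.
- by apply: eq_integral => s _; rewrite /= mulr1.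
- lra.
- by move=> x y _ _ xy; lra.
- by move=> x _; exact: cvg_cst.
- exact: is_cvg_cst.
- exact: is_cvg_cst.
- split; first by move=> x _; case: (dF x).
  + exact: cvg_at_right_filter.
  + exact: cvg_at_left_filter.
- exact: finsler_lift_continuous.
Qed.

(** Chains of C^1 paths of total length [L] from a point to another: each path
   starts where the previous one ends, but their parameters are unrelated. *)
Inductive C1_chain : M -> M -> R -> Prop :=
| C1_chain_nil p : C1_chain p p 0
| C1_chain_cons c d W q L : c < d -> C1_lift c d W ->
    C1_chain (projT1 (W d)) q L ->
    C1_chain (projT1 (W c)) q (lift_length F c d W + L).

Lemma C1_pieces_chain beta a b L :
  C1_pieces F beta a b L -> C1_chain (beta a) (beta b) L.
Proof.
elim=> {a b L}[a|a c b W L ac Wl Wb _ IH]; first by constructor.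
by rewrite -Wb ?lexx ?ltW//; apply: C1_chain_cons => //; rewrite Wb ?lexx ?ltW.
Qed.

(** Translations of the parameters turn a chain into a piecewise C^1 path. *)
Lemma C1_chain_pieces p q L : C1_chain p q L ->
  exists a b beta, [/\ C1_pieces F beta a b L, beta a = p & beta b = q].
Proof.
elim=> {p q L}[p|c d W q L cd Wl _ [a [b [beta [P ba bb]]]]].
  by exists 0, 0, (fun=> p); split => //; constructor.
pose h := a - d; have ch : c + h < a by rewrite /h; lra.
have dh : d + h = a by rewrite /h; lra.
have ab := C1_pieces_le P.
pose beta' t := if t <= a then projT1 (W (t - h)) else beta t.
exists (c + h), b, beta'; split.
- have := C1_lift_shift h Wl; rewrite dh => Wl'.
  rewrite -(lift_length_shift h cd Wl) dh; constructor => //.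
    by move=> t /andP[_ ta]; rewrite /beta' ta.
  apply: C1_pieces_eq P => t /andP[at_ tb]; rewrite /beta'.
  by case: ifPn => // ta; have -> : t = a by [lra]; rewrite ba /h opprB addrC subrK.
- by rewrite /beta' ltW// addrK.
- rewrite /beta'; case: ifPn => // ba'; have ab' : b = a by lra.
  by rewrite -bb ab' ba /h opprB addrC subrK.
Qed.

Lemma C1_chain_ge0 p q L : C1_chain p q L -> 0 <= L.
Proof. by elim=> // *; rewrite addr_ge0 ?lift_length_ge0. Qed.

Lemma C1_chain_trans p q r L K :
  C1_chain p q L -> C1_chain q r K -> C1_chain p r (L + K).
Proof.
elim=> {p q L}[p|c d W q L cd Wl _ IH] qr; first by rewrite add0r.
by rewrite -addrA; apply: C1_chain_cons => //; exact: IH.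
Qed.

Lemma C1_chain1 c d W : c < d -> C1_lift c d W ->
  C1_chain (projT1 (W c)) (projT1 (W d)) (lift_length F c d W).
Proof.
move=> cd Wl; rewrite -[lift_length _ _ _ _]addr0.
by apply: C1_chain_cons => //; constructor.
Qed.

Lemma C1_chain_split p q L r : C1_chain p q L -> 0 <= r <= L ->
  exists2 z, C1_chain p z r & C1_chain z q (L - r).
Proof.
move=> pq; elim: pq r => {p q L}[p r r0|c d W q L cd Wl dq IH r r0].
  have -> : r = 0 by lra.
  by exists p; rewrite ?subr0; constructor.
have [rl|lr] := leP (lift_length F c d W) r.
  have [z dz zq] := IH (r - lift_length F c d W) ltac:(lra).
  exists z; last by have -> : lift_length F c d W + L - r =
    L - (r - lift_length F c d W) by lra.
  have -> : r = lift_length F c d W + (r - lift_length F c d W) by lra.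
  exact: C1_chain_cons.
have lc : {within `[c, d], continuous (fun x => lift_length F c x W)}.
  apply: parameterized_integral_continuous; first exact: ltW.
  exact: finsler_lift_integrable.
have [|e] := IVT (ltW cd) lc (v := r).
  rewrite lift_length0 min_l ?lift_length_ge0// max_r ?lift_length_ge0//; lra.
rewrite in_itv /= => /andP[ce ed] er.
have -> : lift_length F c d W + L - r = lift_length F e d W + L.
  by rewrite (@lift_lengthD _ _ _ _ c e d)//; lra.
exists (projT1 (W e)).
- rewrite -er; move: ce; rewrite le_eqVlt => /predU1P[<-|ce].
    by rewrite lift_length0; constructor.
  by apply: C1_chain1 => //; apply: C1_liftS Wl.
- move: ed; rewrite le_eqVlt => /predU1P[->|ed].
    by rewrite lift_length0 add0r.
  by apply: C1_chain_cons => //; apply: C1_liftS Wl.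
Qed.

(** With the next lemma: the Finsler distance is the infimum of the lengths of
   the chains. *)
Lemma finsler_dist_le_chain p q L : C1_chain p q L ->
  (finsler_dist F p q <= L%:E)%E.
Proof.
move=> /C1_chain_pieces[a [b [beta [P <- <-]]]].
apply: ereal_inf_lbound; exists a, b, beta; split => //.
- exact: C1_pieces_piecewise P.
- by rewrite (C1_pieces_length P).
Qed.

Lemma finsler_dist_lt_chain p q L : (finsler_dist F p q < L)%E ->
  exists2 K, (K%:E < L)%E & C1_chain p q K.
Proof.
move=> /ereal_inf_lt[_ [a [b [beta [/piecewise_C1_pieces-/(_ F)[K P] <- <- ->]]]]].
by rewrite (C1_pieces_length P) => KL; exists K => //; exact: C1_pieces_chain.
Qed.

Lemma finsler_dist_ge0 p q : (0 <= finsler_dist F p q)%E.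
Proof.
rewrite leNgt; apply/negP => /finsler_dist_lt_chain[K + /C1_chain_ge0 K0].
by rewrite lte_fin ltNge K0.
Qed.

Lemma finsler_distxx p : finsler_dist F p p = 0%E.
Proof.
apply/eqP; rewrite eq_le finsler_dist_ge0 andbT.
by apply: finsler_dist_le_chain; constructor.
Qed.

Lemma finsler_dist_triangle p q r :
  (finsler_dist F p r <= finsler_dist F p q + finsler_dist F q r)%E.
Proof.
have := finsler_dist_ge0 p q; have := finsler_dist_ge0 q r.
case pqE : (finsler_dist F p q) => [a| |] //; last first.
  by move=> qr0 _; rewrite addye ?leey//; apply: contraTneq qr0 => ->.
case qrE : (finsler_dist F q r) => [b| |] // _ _; last by rewrite leey.
apply/lee_addgt0Pr => e e0.
have [|K] := @finsler_dist_lt_chain p q (a + e / 2)%:E.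
  by rewrite pqE lte_fin; lra.
rewrite lte_fin => Ka pqK.
have [|K'] := @finsler_dist_lt_chain q r (b + e / 2)%:E.
  by rewrite qrE lte_fin; lra.
rewrite lte_fin => Kb qrK.
apply: (le_trans (finsler_dist_le_chain (C1_chain_trans pqK qrK))).
by rewrite -!EFinD lee_fin; lra.
Qed.

Lemma finsler_dist_split p q (r s : R) : (finsler_dist F p q < s%:E)%E ->
  0 <= r <= s ->
  exists2 z, (finsler_dist F p z <= r%:E)%E & (finsler_dist F z q <= (s - r)%:E)%E.
Proof.
move=> /finsler_dist_lt_chain[L]; rewrite lte_fin => Ls pq rs.
have [rL|Lr] := leP r L.
  have [|z pz zq] := C1_chain_split (r := r) pq; first lra.
  exists z; first exact: finsler_dist_le_chain.
  by apply: (le_trans (finsler_dist_le_chain zq)); rewrite lee_fin; lra.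
exists q; last by rewrite finsler_distxx lee_fin; lra.
by apply: (le_trans (finsler_dist_le_chain pq)); rewrite lee_fin ltW.
Qed.

End Chains.

(** * Charts of the tangent bundle *)

Section Charts.
Context {R : realType} {n : nat} {M : smooth_manifold R n}.
Implicit Types (i j k : chart_index M) (x : M).

Lemma transition_differentiable i j x : chart_dom i x -> chart_dom j x ->
  differentiable (chart j \o chart_inv i) (chart i x).
Proof.
move=> xi xj; have [h _] := transition_smooth i j 1; apply: h.
by exists x.
Qed.

Lemma chart_image_nbhs i x (U : set M) : chart_dom i x -> nbhs x U ->
  \forall q \near chart i x, chart_dom i (chart_inv i q) /\ U (chart_inv i q) /\
    chart i (chart_inv i q) = q.
Proof.
move=> xi xU.
have Iq : (chart i @` chart_dom i) (chart i x) by exists x.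
have h1 : nbhs (chart i x) (chart i @` chart_dom i).
  by apply: open_nbhs_nbhs; split => //; exact: chart_image_open.
have h2 : \forall q \near chart i x, U (chart_inv i q).
  by apply: (chart_inv_continuous Iq); rewrite chartK.
by apply: filterS2 h1 h2 => _ [y yi <-]; rewrite chartK.
Qed.

Lemma chart_dom_nbhs i x : chart_dom i x -> nbhs x (chart_dom i).
Proof. by move=> xi; apply: open_nbhs_nbhs; split => //; exact: chart_dom_open. Qed.

Lemma diff_transition_comp i j k x v :
  chart_dom i x -> chart_dom j x -> chart_dom k x ->
  'd (chart k \o chart_inv i) (chart i x) v =
  'd (chart k \o chart_inv j) (chart j x) ('d (chart j \o chart_inv i) (chart i x) v).
Proof.
move=> xi xj xk; have ij := transition_differentiable xi xj.
have jk := transition_differentiable xj xk.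
have jk' : differentiable (chart k \o chart_inv j)
    ((chart j \o chart_inv i) (chart i x)).
  by rewrite /= chartK.
have E : (chart j \o chart_inv i) (chart i x) = chart j x by rewrite /= chartK.
transitivity ('d ((chart k \o chart_inv j) \o (chart j \o chart_inv i))
    (chart i x) v); last first.
  have H := diff_comp ij jk'.
  have H2 := congr1 (fun h : 'rV[R]_n -> 'rV[R]_n => h v) H.
  apply: (etrans H2) => {H H2}.
  exact: (congr1 (fun q => 'd (chart k \o chart_inv j) q
    ('d (chart j \o chart_inv i) (chart i x) v)) E).
apply: near_eq_diff.
- exact: transition_differentiable.
- exact: differentiable_comp.
- have := chart_image_nbhs xi (chart_dom_nbhs xj).
  by apply: filterS => q [_ [qj _]] /=; rewrite chartK.
Qed.

Lemma diff_transition_id i x v : chart_dom i x ->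
  'd (chart i \o chart_inv i) (chart i x) v = v.
Proof.
move=> xi; rewrite (near_eq_diff (g := id)).
- by rewrite diff_val.
- exact: transition_differentiable.
- exact: ex_diff.
- have := chart_image_nbhs xi (chart_dom_nbhs xi).
  by apply: filterS => q [_ [_]].
Qed.

(** The components in all charts of the tangent vector at [chart_inv i q] whose
   component in the chart [i] is [v]. *)
Definition chart_components i (q v : 'rV[R]_n) (j : chart_index M) : 'rV[R]_n :=
  if `[< chart_dom j (chart_inv i q) >] then 'd (chart j \o chart_inv i) q v else 0.

Lemma chart_components_tangent i x v : chart_dom i x ->
  chart_components i (chart i x) v \in is_tangent (chart_inv i (chart i x)).
Proof.
move=> xi; rewrite /chart_components chartK//; apply/asboolP; split.
  by move=> j xj; case: asboolP.
move=> j k xj xk; do 2 (case: asboolP => // _).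
exact: diff_transition_comp.
Qed.

(** The inverse of the chart [tchart i] of the tangent bundle; the default value
   of [insubd] matters only outside the image of the chart [i]. *)
Definition chart_lift i (z : 'rV[R]_n * 'rV[R]_n) : tangent_bundle M :=
  tvec (insubd (0 : tangent (chart_inv i z.1)) (chart_components i z.1 z.2)).

Lemma chart_lift_val i (z : 'rV[R]_n * 'rV[R]_n) j :
  (chart i @` chart_dom i) z.1 -> chart_dom j (chart_inv i z.1) ->
  tangent_val (projT2 (chart_lift i z)) j = 'd (chart j \o chart_inv i) (z.1) z.2.
Proof.
case: z => _ v /= [x xi <-] xj; rewrite /chart_lift /=.
have := insubdK (0 : tangent (chart_inv i (chart i x))) (chart_components_tangent v xi).
by rewrite /= => ->; rewrite /chart_components; case: asboolP.
Qed.

Lemma tchartK i z : (chart i @` chart_dom i) z.1 -> tchart i (chart_lift i z) = z.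
Proof.
case: z => q v iq; have [x xi xq] := iq; rewrite /= in xq.
rewrite /tchart chart_lift_val//= -?xq ?chartK//.
by rewrite diff_transition_id.
Qed.

Lemma chart_liftK i u : chart_dom i (projT1 u) -> chart_lift i (tchart i u) = u.
Proof.
move=> ui; have iq : (chart i @` chart_dom i) (tchart i u).1 by exists (projT1 u).
have [|v vE] := @tvecP _ _ _ (chart_lift i (tchart i u)) (projT1 u).
  by rewrite /= chartK.
have val_v j : chart_dom j (projT1 u) -> tangent_val v j =
    'd (chart j \o chart_inv i) ((tchart i u).1) (tchart i u).2.
  by move=> uj; rewrite -chart_lift_val ?vE//= chartK.
rewrite vE; case: u ui {iq vE} v val_v => x w /= xi v val_v.
congr tvec; apply: tangent_inj => j xj; rewrite val_v//.
by case: w {val_v} => w wT /=; move: wT => /asboolP[_ <-].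
Qed.

Lemma chart_lift_continuous i z : (chart i @` chart_dom i) z.1 ->
  {for z, continuous (chart_lift i)}.
Proof.
move=> iz A /=; rewrite nbhsE => -[B [Bo Bz] BA].
have [W Wo WB] := Bo i.
have Wz : nbhs z W.
  apply: open_nbhs_nbhs; split => //; have [x xi xz] := iz.
  have := WB (chart_lift i z); rewrite (tchartK iz) => h; apply/h => //.
  by rewrite /= -xz chartK.
have nz : \forall z' \near z, (chart i @` chart_dom i) z'.1.
  apply: cvg_fst; apply: open_nbhs_nbhs; split => //; exact: chart_image_open.
suff : \forall z' \near z, A (chart_lift i z') by [].
apply: filterS2 Wz nz => z' Wz' iz'; apply: BA.
have [x xi xz] := iz'; apply/WB; last by rewrite tchartK.
by rewrite /= -xz chartK.
Qed.

Lemma chart_liftZ i q (a : R) v : (chart i @` chart_dom i) q ->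
  chart_lift i (q, a *: v) = tvec (a *: projT2 (chart_lift i (q, v))).
Proof.
move=> iq; congr tvec; apply: tangent_inj => j qj.
have := @chart_lift_val i (q, a *: v) j iq qj; rewrite /= => ->.
have := @chart_lift_val i (q, v) j iq qj; rewrite /= => e.
transitivity (a *: 'd (chart j \o chart_inv i) q v); first by rewrite linearZ.
by rewrite -e.
Qed.

Lemma chart_lift_eq0 i q v : (chart i @` chart_dom i) q ->
  projT2 (chart_lift i (q, v)) = 0 -> v = 0.
Proof.
move=> iq v0; have h : tangent_val (projT2 (chart_lift i (q, v))) i = v :=
  congr1 snd (@tchartK i (q, v) iq).
by rewrite -h v0.
Qed.

End Charts.

(** * Comparison of the Finsler structure with the norm of a chart *)

Section LocalBounds.
Context {R : realType} {n : nat} {M : smooth_manifold R n} (F : finsler M).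
Implicit Types (i j k : chart_index M) (p : M).

Lemma finsler_chart_continuous i z : (chart i @` chart_dom i) z.1 ->
  {for z, continuous (fun z => F (chart_lift i z))}.
Proof.
move=> iz; have Ft := @finsler_continuous _ _ _ F (chart_lift i z).
exact: (@continuous_comp _ _ _ (chart_lift i) F z (chart_lift_continuous iz) Ft).
Qed.

Lemma finsler_chartZ i q (a : R) v : (chart i @` chart_dom i) q -> 0 <= a ->
  F (chart_lift i (q, a *: v)) = a * F (chart_lift i (q, v)).
Proof. by move=> iq a0; rewrite chart_liftZ// finsler_homog. Qed.

Lemma finsler_chart_gt0 i q v : (chart i @` chart_dom i) q -> v != 0 ->
  0 < F (chart_lift i (q, v)).
Proof.
move=> iq v0; rewrite lt_neqAle finsler_ge0 andbT eq_sym.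
by apply: contra_neq v0 => /finsler_eq0; exact: chart_lift_eq0.
Qed.

(** Near a point, the Finsler norm is comparable with the norm of the component
   in a chart: by homogeneity it is enough to compare them on the product of a
   ball and the unit sphere, which is compact. *)
Lemma finsler_chart_bounds i p : chart_dom i p -> exists r c C : R,
  [/\ 0 < r, 0 < c, 0 < C,
    forall q, `|q - chart i p| <= r -> (chart i @` chart_dom i) q &
    forall q v, `|q - chart i p| <= r ->
      c * `|v| <= F (chart_lift i (q, v)) <= C * `|v|].
Proof.
move=> pi.
have : nbhs (chart i p) (chart i @` chart_dom i).
  by apply: open_nbhs_nbhs; split; [exact: chart_image_open|exists p].
move=> /nbhs_ballP[e /= e0 eP]; pose r := e / 2.
have rP q : `|q - chart i p| <= r -> (chart i @` chart_dom i) q.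
  move=> qr; apply: eP; rewrite -ball_normE /= distrC (le_lt_trans qr)//.
  by rewrite /r; lra.
have r0 : 0 < r by rewrite /r; lra.
pose K := [set q : 'rV[R]_n | `|q - chart i p| <= r] `*` [set v : 'rV[R]_n | `|v| = 1].
have cK : compact K.
  by apply: compact_setX; [exact: compact_norm_ball|exact: compact_norm_sphere].
have unit_norm (v : 'rV[R]_n) : v != 0 -> `| `|v|^-1 *: v | = 1.
  by move=> v0; rewrite normrZ normfV normr_id mulVf// normr_eq0.
have scale (v : 'rV[R]_n) : v != 0 -> v = `|v| *: (`|v|^-1 *: v).
  by move=> v0; rewrite scalerA mulfV ?normr_eq0// scale1r.
have F0 q : `|q - chart i p| <= r -> F (chart_lift i (q, 0)) = 0.
  by move=> qr; rewrite -[X in (q, X)](scale0r 0) finsler_chartZ ?mul0r//; exact: rP.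
(* in dimension 0 the unit sphere is empty, and so is K *)
have [K0|K0] := pselect (K !=set0); last first.
  exists r, 1, 1; split => // q v qr; have [->|v0] := eqVneq v 0.
    by rewrite F0// normr0 mulr0 lexx.
  by exfalso; apply: K0; exists (q, `|v|^-1 *: v); split => //=; exact: unit_norm.
have cF : {within K, continuous (fun z => F (chart_lift i z))}.
  apply: continuous_in_subspaceT => z /set_mem[zr _].
  by apply: finsler_chart_continuous; exact: rP.
have [z1 /set_mem[z1r z11] z1P] := compact_EVT_min K0 cK cF.
have [z2 /set_mem[z2r z21] z2P] := compact_EVT_max K0 cK cF.
have pos z : K z -> 0 < F (chart_lift i z).
  case: z => q v [/= qr v1]; apply: finsler_chart_gt0; first exact: rP.
  by rewrite -normr_gt0 v1.
exists r, (F (chart_lift i z1)), (F (chart_lift i z2)); split => //.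
- exact: pos.
- exact: pos.
move=> q v qr; have [->|v0] := eqVneq v 0.
  by rewrite F0// normr0 !mulr0 lexx.
have Kv : (q, `|v|^-1 *: v) \in K.
  by apply/mem_set; split => //=; exact: unit_norm.
rewrite [X in chart_lift i (q, X)]scale// finsler_chartZ//; last exact: rP.
by rewrite !(mulrC _ `|v|) !ler_wpM2l// ?z1P ?z2P.
Qed.

(** A straight segment in a chart is a C^1 path. *)
Lemma chart_segment_lift i (q w : 'rV[R]_n) : (forall t : R, 0 <= t <= 1 ->
    (chart i @` chart_dom i) (q + t *: w)) ->
  C1_lift 0 1 (fun t : R => chart_lift i (q + t *: w, w)).
Proof.
move=> img; split => [t t01 j|].
- rewrite /= => tj.
  rewrite (@chart_lift_val _ _ _ i (q + t *: w, w) j (img t t01) tj) /=.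
  have [x xi xq] := img t t01.
  have tr : differentiable (chart j \o chart_inv i) (q + t *: w).
    by rewrite -xq; apply: transition_differentiable => //; rewrite -(chartK xi) xq.
  have h := diff_quotient_cvg (w := w) t tr.
  apply: cvg_trans h; apply: (cvg_trans (cvg_fmap2 (cvg_within _))).
  apply: near_eq_cvg; apply: nearW => s /=.
  have -> // : q + t *: w + (s - t) *: w = q + s *: w.
  by rewrite -addrA -scalerDl [t + _]addrC subrK.
- apply: continuous_in_subspaceT => t /set_mem; rewrite /= in_itv /= => t01.
  apply: continuous_comp; last by apply: chart_lift_continuous; exact: img.
  have c1 : (fun s : R => q + s *: w) @ t --> q + t *: w.
    by apply: cvgD; [exact: cvg_cst|apply: cvgZr_tmp; exact: cvg_id].
  have c2 : (fun _ : R => w) @ t --> w by exact: cvg_cst.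
  exact: cvg_pair c1 c2.
Qed.

End LocalBounds.

Section Speed.
Context {R : realType} {n : nat} {M : smooth_manifold R n} (F : finsler M).
Implicit Types (i j k : chart_index M) (p : M).

(** A C^1 path inside a chart moves the coordinates by at most its length, up
   to the constant that bounds the Finsler norm from below. *)
Lemma lift_chart_speed i p (r c s t : R) W : 0 < c -> s <= t -> C1_lift s t W ->
  (forall q v, `|q - chart i p| <= r -> c * `|v| <= F (chart_lift i (q, v))) ->
  (forall x, s <= x <= t -> chart_dom i (projT1 (W x)) /\
    `|chart i (projT1 (W x)) - chart i p| <= r) ->
  c * `|chart i (projT1 (W t)) - chart i (projT1 (W s))| <= lift_length F s t W.
Proof.
move=> c0 st Wl bnd inr; have [WP Wc] := Wl.
have cc : {within `[s, t], continuous (fun x => chart i (projT1 (W x)))}.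
  apply/subspace_continuousP => x xst.
  have [|xi _] := inr x; first by move: xst; rewrite /= in_itv.
  have h1 := proj1 (subspace_continuousP _ _) Wc x xst.
  have h2 := @projT1_tangent_continuous _ _ M (W x).
  have h3 := chart_continuous xi.
  exact: (cvg_comp _ _ (cvg_comp _ _ h1 h2) h3).
rewrite -ler_pdivlMl// ; apply: norm_le_coord => [|j].
  by rewrite mulr_ge0 ?invr_ge0 ?(ltW c0)// lift_length_ge0.
rewrite ler_pdivlMl//.
pose l x := c * chart i (projT1 (W x)) 0 j.
have -> : c * `|(chart i (projT1 (W t)) - chart i (projT1 (W s))) 0 j| = `|l t - l s|.
  by rewrite /l -mulrBr normrM (gtr0_norm c0) !mxE.
have coc : continuous (fun v : 'rV[R]_n => c * v 0 j).
  move=> v; have cv := @coord_continuous R 1 n 0 j v.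
  exact: (cvgM (cvg_cst c) cv).
apply: le_integral_derive => //.
- exact: finsler_lift_continuous.
- by move=> x; apply: (cvg_comp _ _ (cc x) (coc _)).
move=> x sxt; have sxt' : s <= x <= t by lra.
have [xi xr] := inr x sxt'; have := WP x sxt' i xi.
rewrite (@within_dnbhs_itv _ _ s t)//; last by apply: subset_itv; rewrite bnd_simp.
move=> /cvg_comp /(_ (coc _)) h.
have [|ld le] := @derive1_quotient _ l x (c * tangent_val (projT2 (W x)) i 0 j).
  apply: cvg_trans h; apply: near_eq_cvg; apply: nearW => y /=.
  by rewrite /l !mxE; ring.
split => //; rewrite le normrM (gtr0_norm c0).
rewrite -[W x in leRHS](chart_liftK xi) /tchart.
apply: le_trans (bnd _ _ xr); rewrite ler_pM2l//; exact: coord_le_norm.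
Qed.

(** The distance to [p] in the chart [i], truncated at [r] so that it extends to
   the whole manifold with the value [r] outside the chart. *)
Definition chart_gap i p (r : R) (x : M) : R :=
  if `[< chart_dom i x >] then Num.min `|chart i x - chart i p| r else r.

Lemma chart_gap_center i p r : chart_dom i p -> 0 <= r -> chart_gap i p r p = 0.
Proof.
by move=> pi r0; rewrite /chart_gap; case: asboolP => // _; rewrite subrr normr0 min_l.
Qed.

Lemma chart_gap_lt i p r x e : e <= r -> chart_gap i p r x < e ->
  chart_dom i x /\ `|chart i x - chart i p| < e.
Proof.
move=> er; rewrite /chart_gap; case: asboolP => [xi|_ re]; last by lra.
by rewrite gt_min => /orP[|re]//; lra.
Qed.

Lemma chart_gap_lip i p r x y : chart_dom i x -> chart_dom i y ->
  `|chart_gap i p r y - chart_gap i p r x| <= `|chart i y - chart i x|.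
Proof.
move=> xi yi; rewrite /chart_gap; do 2 (case: asboolP => // _).
have := ler_dist_dist (chart i y - chart i p) (chart i x - chart i p).
rewrite opprB addrA subrK !ler_norml /Num.min.
set a := `|_|; set b := `|_|; set d := `|_|.
by case: ifPn; case: ifPn; rewrite -?leNgt; lra.
Qed.

Lemma compact_chart_ball i p (r : R) :
  (forall q, `|q - chart i p| <= r -> (chart i @` chart_dom i) q) ->
  compact [set x | chart_dom i x /\ `|chart i x - chart i p| <= r].
Proof.
move=> img.
have -> : [set x | chart_dom i x /\ `|chart i x - chart i p| <= r] =
    chart_inv i @` [set q | `|q - chart i p| <= r].
  apply/seteqP; split => [x [xi xr]|_ [q qr <-]].
    by exists (chart i x) => //; exact: chartK.
  by have [y yi yq] := img q qr; rewrite /= in yq; rewrite /= -yq chartK// yq.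
apply: continuous_compact; last exact: compact_norm_ball.
apply: continuous_in_subspaceT => q /set_mem /img; exact: chart_inv_continuous.
Qed.

(** The chart distance to [p], truncated at [e], is Lipschitz with respect to the
   length of any C^1 path, wherever the path goes. This holds near the times at
   which the path is in the closed chart ball of radius [e], by
   [lift_chart_speed], and near the other times because the truncated distance is
   then locally constant; [segment_induction] globalizes. *)
Lemma lift_gap_speed i p (r e c s t : R) W : 0 < c -> e < r -> s <= t ->
  (forall q, `|q - chart i p| <= r -> (chart i @` chart_dom i) q) ->
  (forall q v, `|q - chart i p| <= r -> c * `|v| <= F (chart_lift i (q, v))) ->
  C1_lift s t W ->
  c * `|chart_gap i p e (projT1 (W t)) - chart_gap i p e (projT1 (W s))|
    <= lift_length F s t W.
Proof.
move=> c0 er st img bnd Wl.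
pose P a b := c * `|chart_gap i p e (projT1 (W b)) - chart_gap i p e (projT1 (W a))|
    <= lift_length F a b W.
apply: (@segment_induction _ s t P) => //.
  move=> x y z sx xy yz zt; rewrite /P => h1 h2.
  have Wxz : C1_lift x z W by apply: C1_liftS Wl => //; lra.
  rewrite (@lift_lengthD _ _ _ _ x y z)//; last by rewrite xy.
  apply: le_trans (lerD h1 h2); rewrite -mulrDr ler_pM2l// [leRHS]addrC.
  exact: ler_distD.
move=> x xst.
have Wx : (fun y => projT1 (W y)) @ within `[s, t] (nbhs x) --> projT1 (W x).
  have xst' : `[s, t]%classic x by rewrite /= in_itv.
  have h1 := proj1 (subspace_continuousP _ _) (proj2 Wl) x xst'.
  exact: (cvg_comp _ _ h1 (@projT1_tangent_continuous _ _ M (W x))).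
have near_ball (U : set M) : nbhs (projT1 (W x)) U ->
    exists2 d, 0 < d & forall y, s <= y <= t -> `|y - x| < d -> U (projT1 (W y)).
  move=> /Wx; rewrite /fmap /= /within /= => H.
  have {}H : \forall y \near x, y \in `[s, t] -> U (projT1 (W y)) := H.
  move: H => /nbhs_ballP[d /= d0 dP]; exists d => // y yst yx; apply: dP.
    by rewrite -ball_normE /= distrC.
  by rewrite in_itv.
have [[xi xr]|nx] := pselect (chart_dom i (projT1 (W x)) /\
    `|chart i (projT1 (W x)) - chart i p| <= e).
- have : nbhs (projT1 (W x)) [set y | chart_dom i y /\ `|chart i y - chart i p| < r].
    apply: filterI; first exact: chart_dom_nbhs.
    have cn : (fun y => `|chart i y - chart i p|) @ projT1 (W x) -->
        `|chart i (projT1 (W x)) - chart i p|.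
      by apply: cvg_norm; apply: cvgB; [exact: chart_continuous|exact: cvg_cst].
    by apply: (cvgr_lt _ cn); lra.
  move=> /near_ball[d d0 dP]; exists d => // a b sa ab bt ax bx.
  have inr y : a <= y <= b -> chart_dom i (projT1 (W y)) /\
      `|chart i (projT1 (W y)) - chart i p| < r.
    by move=> yab; apply: dP; [lra|move: ax bx; rewrite !ltr_norml; lra].
  have Wab : C1_lift a b W by apply: C1_liftS Wl.
  rewrite /P; apply: le_trans
    (lift_chart_speed (i := i) (p := p) (r := r) c0 ab Wab bnd _).
    rewrite ler_pM2l//; apply: chart_gap_lip.
    + by have [] := inr a ltac:(lra).
    + by have [] := inr b ltac:(lra).
  by move=> y /inr[? /ltW].
- (* compact sets are closed, hence leaving this one is an open condition *)
  have cK : compact [set y | chart_dom i y /\ `|chart i y - chart i p| <= e].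
    by apply: compact_chart_ball => q qe; apply: img; lra.
  have oK := closed_openC (compact_closed (@mfd_hausdorff _ _ M) cK).
  have [d d0 dP] := near_ball _ (open_nbhs_nbhs (conj oK nx)).
  exists d => // a b sa ab bt ax bx.
  have gap_e y : s <= y <= t -> `|y - x| < d -> chart_gap i p e (projT1 (W y)) = e.
    move=> yst yx; have := dP y yst yx; rewrite /chart_gap /=.
    case: asboolP => // yi /not_andP[//|/negP]; rewrite -ltNge => /ltW.
    by move=> /min_r.
  by rewrite /P !gap_e ?subrr ?normr0 ?mulr0 ?lift_length_ge0//; lra.
Qed.

End Speed.

(** * The Finsler distance and its geodesics *)

Section Assemble.
Context {R : realType} {n : nat} {M : smooth_manifold R n} (F : finsler M).
Implicit Types (i j k : chart_index M) (p : M).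

Lemma chain_gap_speed i p (r e c : R) x y L : 0 < c -> e < r ->
  (forall q, `|q - chart i p| <= r -> (chart i @` chart_dom i) q) ->
  (forall q v, `|q - chart i p| <= r -> c * `|v| <= F (chart_lift i (q, v))) ->
  C1_chain F x y L -> c * `|chart_gap i p e y - chart_gap i p e x| <= L.
Proof.
move=> c0 er img bnd; elim=> {x y L}[x|a b W y L ab Wl _ IH].
  by rewrite subrr normr0 mulr0.
apply: le_trans (lerD (lift_gap_speed c0 er (ltW ab) img bnd Wl) IH).
by rewrite -mulrDr ler_pM2l// [leRHS]addrC; exact: ler_distD.
Qed.

(** A path between [p] and a point outside a neighbourhood of [p], in either
   direction, has a length that is bounded from below. *)
Lemma finsler_dist_sep p (U : set M) : nbhs p U -> exists2 e : R, 0 < e &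
  forall q, (finsler_dist F p q < e%:E)%E \/ (finsler_dist F q p < e%:E)%E -> U q.
Proof.
move=> pU; have [i pi] := chart_cover p.
have [r [c [C [r0 c0 _ img bnd]]]] := finsler_chart_bounds F pi.
have bnd' q v : `|q - chart i p| <= r -> c * `|v| <= F (chart_lift i (q, v)).
  by move=> /bnd -/(_ v)/andP[].
have [d /= d0 dP] := iffLR (nbhs_ballP _ _) (chart_image_nbhs pi pU).
pose e := Num.min (r / 2) d.
have e0 : 0 < e by rewrite lt_min d0 andbT; lra.
have er : e < r by have : e <= r / 2 by [rewrite ge_min lexx]; lra.
have ed : e <= d by rewrite ge_min lexx orbT.
exists (c * e); first exact: mulr_gt0.
move=> q pq.
have : chart_gap i p e q < e.
  have p0 := @chart_gap_center _ _ _ i p e pi (ltW e0).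
  rewrite -(ltr_pM2l c0); case: pq => /finsler_dist_lt_chain[L]; rewrite lte_fin => Le.
    move=> /(chain_gap_speed c0 er img bnd') h; apply: le_lt_trans Le.
    by apply: le_trans h; rewrite p0 subr0 ler_pM2l// ler_norm.
  move=> /(chain_gap_speed c0 er img bnd') h; apply: le_lt_trans Le.
  by apply: le_trans h; rewrite p0 sub0r normrN ler_pM2l// ler_norm.
move=> /(chart_gap_lt (lexx _))[qi qe].
have [|_ [+ _]] := dP (chart i q).
  by rewrite -ball_normE /= distrC; apply: lt_le_trans ed.
by rewrite chartK.
Qed.

(** Points near [p] are joined to [p], in both directions, by short straight
   segments in a chart. *)
Lemma finsler_dist_near p (e : R) : 0 < e ->
  \forall q \near p, (finsler_dist F p q < e%:E)%E /\ (finsler_dist F q p < e%:E)%E.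
Proof.
move=> e0; have [i pi] := chart_cover p.
have [r [c [C [r0 _ C0 img bnd]]]] := finsler_chart_bounds F pi.
have seg (a b : 'rV[R]_n) : `|a - chart i p| <= r -> `|b - chart i p| <= r ->
    (finsler_dist F (chart_inv i a) (chart_inv i b) <= (C * `|b - a|)%:E)%E.
  move=> ar br.
  have inr t : 0 <= t <= 1 -> `|a + t *: (b - a) - chart i p| <= r.
    move=> t01.
    have -> : a + t *: (b - a) - chart i p =
        (1 - t) *: (a - chart i p) + t *: (b - chart i p).
      rewrite !scalerBr !scalerBl !scale1r; apply/matrixP => u v; rewrite !mxE; ring.
    apply: le_trans (ler_normD _ _) _; rewrite !normrZ !ger0_norm; [|lra|lra].
    have : (1 - t) * `|a - chart i p| <= (1 - t) * r by apply: ler_wpM2l => //; lra.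
    have : t * `|b - chart i p| <= t * r by apply: ler_wpM2l => //; lra.
    lra.
  have Wl : C1_lift 0 1 (fun t : R => chart_lift i (a + t *: (b - a), b - a)).
    by apply: chart_segment_lift => t /inr; exact: img.
  have := finsler_dist_le_chain (C1_chain1 F ltr01 Wl).
  rewrite /= scale0r addr0 scale1r addrC subrK => h; apply: (le_trans h).
  rewrite lee_fin /lift_length.
  have -> : C * `|b - a| = \int[@lebesgue_measure R]_(x in `[0, 1]) (C * `|b - a|).
    rewrite Rintegral_cst// [X in fine X](_ : _ = 1%E) ?mulr1//.
    by have := @lebesgue_measure_itv R `[0, 1]; rewrite /= lte_fin ltr01 oppr0 adde0.
  apply: le_Rintegral => //.
  - exact: finsler_lift_integrable Wl.
  - apply: continuous_compact_integrable; first exact: segment_compact.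
    by apply: continuous_subspaceT => x; exact: cvg_cst.
  - move=> x; rewrite /= in_itv /= => /inr /bnd -/(_ (b - a))/andP[_]; exact.
pose d := Num.min r (e / C).
have d0 : 0 < d by rewrite lt_min r0 divr_gt0.
have pr : `|chart i p - chart i p| <= r by rewrite subrr normr0 ltW.
have ci : (fun y => `|chart i y - chart i p|) @ p --> `|chart i p - chart i p|.
  by apply: cvg_norm; apply: cvgB; [exact: chart_continuous|exact: cvg_cst].
rewrite subrr normr0 in ci.
have qd : \forall q \near p, `|chart i q - chart i p| < d by exact: (cvgr_lt _ ci).
have qi := chart_dom_nbhs pi.
apply: filterS2 qd qi => q qd qi.
have qr : `|chart i q - chart i p| <= r.
  by apply: ltW; apply: (lt_le_trans qd); rewrite ge_min lexx.
have qe : C * `|chart i q - chart i p| < e.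
  rewrite mulrC -ltr_pdivlMr//; apply: (lt_le_trans qd).
  by rewrite ge_min lexx orbT.
have h1 := seg _ _ pr qr; have h2 := seg _ _ qr pr.
rewrite !chartK// in h1 h2.
split; first by apply: (le_lt_trans h1); rewrite lte_fin.
by apply: (le_lt_trans h2); rewrite lte_fin distrC.
Qed.

Lemma finsler_length_space : asymmetric_length_space (finsler_dist F).
Proof.
split.
- exact: finsler_dist_ge0.
- exact: finsler_distxx.
- exact: finsler_dist_triangle.
- exact: finsler_dist_near.
- exact: finsler_dist_sep.
- exact: finsler_dist_split.
Qed.

Lemma finsler_manifold_locally_compact p : exists2 U, nbhs p U & compact U.
Proof.
have [i pi] := chart_cover p.
have [r [c [C [r0 _ _ img _]]]] := finsler_chart_bounds F pi.
exists [set x | chart_dom i x /\ `|chart i x - chart i p| <= r]; last first.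
  exact: compact_chart_ball.
apply: filterI; first exact: chart_dom_nbhs.
have ci : (fun y => `|chart i y - chart i p|) @ p --> `|chart i p - chart i p|.
  by apply: cvg_norm; apply: cvgB; [exact: chart_continuous|exact: cvg_cst].
rewrite subrr normr0 in ci.
have : \forall q \near p, `|chart i q - chart i p| < r by exact: (cvgr_lt _ ci).
by apply: filterS => q /ltW.
Qed.

End Assemble.

(** The points at finite distance from [x] form a clopen set. *)
Lemma dist_lty_component (R : realType) (T : topologicalType)
    (d : T -> T -> \bar R) (x y : T) : asymmetric_length_space d ->
  connected_component [set: T] x y -> (d x y < +oo)%E.
Proof.
move=> dH [B [Bx _ Bc] By].
pose A := [set z | (d x z < +oo)%E].
have lty p q : (d p q < 1%:E)%E -> (d x p < +oo)%E -> (d x q < +oo)%E.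
  move=> pq xp; apply: (le_lt_trans (als_triangle dH x p q)).
  by rewrite lte_add_pinfty// (lt_trans pq)// ltry.
have Ao : open A.
  rewrite openE => z Az; have := als_near dH z (ltr01 : 0 < 1 :> R).
  by apply: filterS => q [zq _]; exact: lty zq Az.
have Ac : closed A.
  rewrite -[A]setCK; apply: open_closedC; rewrite openE => z nAz.
  have := als_near dH z (ltr01 : 0 < 1 :> R).
  by apply: filterS => q [_ qz] Aq; apply: nAz; exact: lty qz Aq.
have AB : B `&` A = B.
  apply: Bc; [|by exists A|by exists A].
  by exists x; split=> //; rewrite /A /= als_refl.
by have [] : (B `&` A) y by rewrite AB.
Qed.

(** A path along which distances are proportional to durations is a geodesic:
   the sums defining its length telescope. *)
Lemma minimizer_geodesic (R : realType) n (M : smooth_manifold R n)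
    (F : finsler M) (gamma : R -> M) (D : R) : 0 <= D ->
  (forall s t, 0 <= s -> s <= t -> t <= 1 ->
    finsler_dist F (gamma s) (gamma t) = (D * (t - s))%:E) ->
  geodesic F 0 1 gamma.
Proof.
move=> D0 gD.
have ml : metric_length F 0 1 gamma = D%:E.
  rewrite /metric_length.
  suff -> : [set l | exists (m : nat) (t : nat -> R),
    [/\ t 0%N = 0, t m.+1 = 1, (forall i, (i <= m)%N -> (t i <= t i.+1)%R) &
        l = (\sum_(0 <= i < m.+1) finsler_dist F (gamma (t i)) (gamma (t i.+1)))%E]]
    = [set D%:E] by rewrite ereal_sup1.
  have sumE m (t : nat -> R) : t 0%N = 0 -> t m.+1 = 1 ->
      (forall i, (i <= m)%N -> t i <= t i.+1) ->
      (\sum_(0 <= i < m.+1) finsler_dist F (gamma (t i)) (gamma (t i.+1)))%E = D%:E.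
    move=> t0 t1 tm.
    have tge i : (i <= m.+1)%N -> 0 <= t i.
      elim: i => [_|i IH im]; first by rewrite t0.
      by apply: (le_trans (IH (ltnW im))); exact: tm.
    have tle i : (i <= m.+1)%N -> t (m.+1 - i)%N <= 1.
      elim: i => [_|i IH im]; first by rewrite subn0 t1.
      apply: le_trans (IH (ltnW im)).
      have := tm (m.+1 - i.+1)%N; rewrite subnS prednK ?subn_gt0//; apply.
      by rewrite -ltnS prednK ?subn_gt0// leq_subr.
    have tle' i : (i <= m.+1)%N -> t i <= 1.
      by move=> im; rewrite -(subKn im); apply: tle; exact: leq_subr.
    transitivity (\sum_(0 <= i < m.+1) (D * (t i.+1 - t i))%:E)%E.
      apply: eq_big_nat => i /andP[_ im]; rewrite gD//.
      - by apply: tge; exact: ltnW.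
      - exact: tm.
      - exact: tle'.
    rewrite sumEFin -mulr_sumr telescope_sumr// t0 t1.
    by rewrite subr0 mulr1.
  apply/seteqP; split => [l [m [t [t0 t1 tm ->]]]|_ ->]; first exact: sumE.
  have tm i : (i <= 0)%N -> (i%:R : R) <= i.+1%:R by rewrite ler_nat.
  by exists 0%N, (fun i => i%:R); split => //; rewrite sumE.
split; last by rewrite ml gD ?lexx ?ler01// subr0 mulr1.
- apply/subspace_continuousP => t; rewrite /= in_itv /= => t01 U /=.
  move=> /(als_sep (finsler_length_space F))[e e0 eP].
  rewrite /within /=.
  suff : \forall s \near t, s \in `[0, 1] -> U (gamma s) by [].
  apply/nbhs_ballP; exists (e / (D + 1)) => /=; first by rewrite divr_gt0//; lra.
  move=> s; rewrite -ball_normE /= => ts; rewrite in_itv /= => s01; apply: eP.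
  rewrite ltr_pdivlMr in ts; last by lra.
  have Dts : D * `|t - s| < e.
    apply: le_lt_trans ts; rewrite mulrC ler_wpM2l//; lra.
  have [st|/ltW st] := leP s t; [right|left]; rewrite gD ?lte_fin//; try lra.
  + by move: Dts; rewrite ger0_norm// subr_ge0.
  + by move: Dts; rewrite distrC ger0_norm// subr_ge0.
- by rewrite /rectifiable ml ltry.
Qed.

Theorem proposition4p13 (R : realType) (n : nat) (M : smooth_manifold R n)
    (F : finsler M) (F_complete : finsler_complete F) (x y : M)
    (xy : connected_component [set: M] x y) :
  exists (a b : R) (gamma : R -> M),
    [/\ a < b, geodesic F a b gamma, gamma a = x & gamma b = y].
Proof.
have dH := finsler_length_space F.
have dfin : finsler_dist F x y \is a fin_num.
  by rewrite ge0_fin_numE ?finsler_dist_ge0//; exact: dist_lty_component dH xy.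
pose D := fine (finsler_dist F x y).
have D0 : 0 <= D by rewrite fine_ge0// finsler_dist_ge0.
have [sigma [s0 sD sP]] := exists_minimizer (@mfd_hausdorff _ _ M)
  (finsler_manifold_locally_compact F) dH F_complete (esym (fineK dfin)).
exists 0, 1, (fun t => sigma (D * t)); split => //.
- apply: (@minimizer_geodesic _ _ _ F _ D D0) => s t s0' st t1.
  rewrite sP ?mulrBr// ?mulr_ge0//; first by rewrite ler_wpM2l.
  by rewrite -[leRHS]mulr1 ler_wpM2l.
- by rewrite mulr0.
- by rewrite mulr1.
Qed.
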